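(* Let $(M,L)$ be a Finsler manifold which admits a concurrent $\pi$-vector field $\overline{\zeta}$. Then the following assertions are equivalent: (a) $(M,L)$ satisfies the $\mathbb{T}$-condition, i.e. for all $\overline{X},\overline{Y},\overline{Z},\overline{W}\in\mathfrak{X}(\pi(M))$, $$L(\nabla_{\gamma\overline{X}}T)(\overline{Y},\overline{Z},\overline{W})+\mathfrak{S}_{\overline{X},\overline{Y},\overline{Z},\overline{W}}\,\ell(\overline{X})\,T(\overline{Y},\overline{Z},\overline{W})=0;$$ (b) $(M,L)$ satisfies the $\mathbb{T}_{o}$-condition, i.e. for all $\overline{X},\overline{Y}\in\mathfrak{X}(\pi(M))$, $$L(\nabla_{\gamma\overline{X}}C)(\overline{Y})+\mathfrak{S}_{\overline{X},\overline{Y}}\,\ell(\overline{X})\,C(\overline{Y})=0;$$ (c) $(M,L)$ is Riemannian.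
   Context: $M$ is a real paracompact smooth manifold of finite dimension $n$; all objects are $C^\infty$. $\pi:\mathcal{T}M\to M$ is the bundle of nonzero tangent vectors, $\pi^{-1}(TM)\to\mathcal{T}M$ the pullback of $TM$ by $\pi$. Sections of $\pi^{-1}(TM)$ are called $\pi$-vector fields, are written with bars, and form the module $\mathfrak{X}(\pi(M))$. The fundamental $\pi$-vector field is $\overline{\eta}(u)=(u,u)$. $\rho:T(\mathcal{T}M)\to\pi^{-1}(TM)$ is $\rho=(\pi_{\mathcal{T}M},d\pi)$, and $\gamma:\pi^{-1}(TM)\to T(\mathcal{T}M)$ is the vertical lift $\gamma(u,v)=j_u(v)$, with $j_u:T_{\pi(u)}M\to T_u(T_{\pi(u)}M)$ the natural isomorphism. $(M,L)$ is a Finsler manifold with Finsler metric $g$ on $\pi^{-1}(TM)$ (locally $g_{ij}=\frac12\partial^2L^2/\partial y^i\partial y^j$). For a linear connection $D$ on $\pi^{-1}(TM)$ its connection map is $K(X)=D_X\overline{\eta}$; $D$ is regular if $T_u(\mathcal{T}M)=V_u(\mathcal{T}M)\oplus\ker K_u$ for all $u$ ($V$ the vertical bundle), and then its horizontal map is $\beta:=(\rho|_{\ker K})^{-1}$. The torsion is $\mathbf{T}(X,Y)=D_X\rho Y-D_Y\rho X-\rho[X,Y]$, with $Q(\overline{X},\overline{Y})=\mathbf{T}(\beta\overline{X},\beta\overline{Y})$ and $(h)hv$-torsion $T(\overline{X},\overline{Y})=\mathbf{T}(\gamma\overline{X},\beta\overline{Y})$. The Cartan connection $\nabla$ is the unique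 regular connection on $\pi^{-1}(TM)$ with $\nabla g=0$, $Q=0$ and $g(T(\overline{X},\overline{Y}),\overline{Z})=g(T(\overline{X},\overline{Z}),\overline{Y})$. Below $\beta,T$ are those of $\nabla$. A $\pi$-vector field $\overline{\zeta}$ is concurrent if $\nabla_{\beta\overline{X}}\overline{\zeta}=-\overline{X}$ and $\nabla_{\gamma\overline{X}}\overline{\zeta}=0$ for all $\overline{X}$. Notation: $\ell(\overline{X}):=L^{-1}g(\overline{X},\overline{\eta})$; Cartan tensor $T(\overline{X},\overline{Y},\overline{Z}):=g(T(\overline{X},\overline{Y}),\overline{Z})$; $C(\overline{X}):=\mathrm{Tr}\{\overline{Y}\mapsto T(\overline{X},\overline{Y})\}$. $\mathfrak{S}$ denotes the cyclic sum over the indicated arguments (four terms for $\mathfrak{S}_{\overline{X},\overline{Y},\overline{Z},\overline{W}}$, two terms for $\mathfrak{S}_{\overline{X},\overline{Y}}$). $(M,L)$ is Riemannian if $g(x,y)$ is independent of $y$ (equivalently $T=0$).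
   Formalization: ''Riemannian'' is taken as T = 0 in every dimension, and as g(x,y) independent of y only for n ≠ 1: for n = 1 the latter form fails (M = R, L = y for y > 0, 2|y| for y < 0, concurrent field -x d/dx). *)

(* Defs.v *)
From HB Require Import structures.
From mathcomp Require Import all_boot all_order all_algebra.
From mathcomp Require Import all_classical all_reals all_analysis.

Set Implicit Arguments.
Unset Strict Implicit.
Unset Printing Implicit Defensive.

Import Order.TTheory GRing.Theory Num.Theory.
Import numFieldNormedType.Exports.

Local Open Scope classical_set_scope.
Local Open Scope ring_scope.

Section Smooth.
Context {R : realType} {V W : normedModType R}.

(* [iter_derive [:: v1; ..; vk] f] is D_v1 (.. (D_vk f)). *)
Fixpoint iter_derive (vs : seq V) (f : V -> W) : V -> W :=
  if vs is v :: vs' then fun x => 'D_v (iter_derive vs' f) x else f.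

(* C^oo on a set that is meant to be open; for finite-dimensional V this is
   the existence and continuity of all iterated partial derivatives. *)
Definition smooth_on (U : set V) (f : V -> W) : Prop :=
  forall x, U x -> forall vs : seq V,
    {for x, continuous (iter_derive vs f)} /\
    forall v, derivable (iter_derive vs f) x v.

Definition smooth_at (x : V) (f : V -> W) : Prop :=
  exists U : set V, [/\ open U, U x & smooth_on U f].

End Smooth.

Definition paracompact (M : topologicalType) : Prop :=
  forall (I : Type) (U : I -> set M),
    (forall i, open (U i)) -> \bigcup_i U i = [set: M] ->
    exists (J : Type) (V : J -> set M),
      [/\ forall j, open (V j),
          \bigcup_j V j = [set: M],
          forall j, exists i, V j `<=` U i
        & forall p, exists N : set M, [/\ open N, N p
            & finite_set [set j | V j `&` N !=set0]]].

Record chart (R : realType) (n : nat) (M : topologicalType) := Chart {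
  cdom : set M;
  cmap : M -> 'rV[R]_n;
  cinv : 'rV[R]_n -> M;
  cdom_open : open cdom;
  cimg_open : open (cmap @` cdom);
  cmapK : {in cdom, cancel cmap cinv};
  cmap_cts : forall p, cdom p -> {for p, continuous cmap};
  cinv_cts : forall x, (cmap @` cdom) x -> {for x, continuous cinv}
}.

(* A smooth atlas, together with a preferred chart at every point. The
   preferred chart at p is used to identify T_p M with 'rV[R]_n. *)
Record smooth_atlas (R : realType) (n : nat) (M : topologicalType) := Atlas {
  in_atlas : set (chart R n M);
  chart_at : M -> chart R n M;
  chart_at_atlas : forall p, in_atlas (chart_at p);
  chart_at_dom : forall p, cdom (chart_at p) p;
  transition_smooth : forall c c', in_atlas c -> in_atlas c' ->
    smooth_on (cmap c @` (cdom c `&` cdom c')) (cmap c' \o cinv c)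
}.

Section TangentBundle.
Context {R : realType} {n : nat} {M : topologicalType}.
Variable (A : smooth_atlas R n M).

Local Notation E := ('rV[R]_n).
Local Notation TM := (M * 'rV[R]_n)%type.

(* A point (p, v) of TM is a point p with a vector v in T_p M given by its
   components in the preferred chart at p. The bundle of nonzero tangent vectors
   is the set [slit]; functions and sections over it are total functions on TM
   whose values at zero vectors are never used. *)
Definition slit : set TM := [set u | u.2 != 0].

(* components in the chart c of the vector v of T_p M *)
Definition vec_coord (c : chart R n M) (p : M) (v : E) : E :=
  'D_v (cmap c \o cinv (chart_at A p)) (cmap (chart_at A p) p).

(* the vector of T_p M whose components in the chart c are y *)
Definition vec_of (c : chart R n M) (p : M) (y : E) : E :=
  'D_y (cmap (chart_at A p) \o cinv c) (cmap c p).

(* the chart (x^i, y^i) of TM induced by a chart (x^i) of M, and its inverse *)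
Definition tm_coord (c : chart R n M) (u : TM) : E * E :=
  (cmap c u.1, vec_coord c u.1 u.2).

Definition tm_of (c : chart R n M) (z : E * E) : TM :=
  (cinv c z.1, vec_of c (cinv c z.1) z.2).

(* A tangent vector of TM at u is the pair (a, b) of its components
   a^i d/dx^i + b^i d/dy^i in the chart of TM induced by the preferred chart
   at u.1. *)
Definition tvec_coord (c : chart R n M) (u : TM) (w : E * E) : E * E :=
  'D_w (tm_coord c \o tm_of (chart_at A u.1)) (tm_coord (chart_at A u.1) u).

(* w . f, for w a tangent vector of TM at u *)
Definition tderive (u : TM) (w : E * E) {W : normedModType R} (f : TM -> W) : W :=
  'D_w (f \o tm_of (chart_at A u.1)) (tm_coord (chart_at A u.1) u).

(* local representatives, in the chart c, of pi-vector fields (sections of the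
   pullback of TM) and of vector fields on the slit tangent bundle *)
Definition pi_rep (c : chart R n M) (s : TM -> E) (z : E * E) : E :=
  vec_coord c (cinv c z.1) (s (tm_of c z)).

Definition vf_rep (c : chart R n M) (X : TM -> E * E) (z : E * E) : E * E :=
  tvec_coord c (tm_of c z) (X (tm_of c z)).

Definition fun_smooth_at (f : TM -> R) (u : TM) : Prop :=
  forall c, in_atlas A c -> cdom c u.1 -> smooth_at (tm_coord c u) (f \o tm_of c).

Definition pi_smooth_at (s : TM -> E) (u : TM) : Prop :=
  forall c, in_atlas A c -> cdom c u.1 -> smooth_at (tm_coord c u) (pi_rep c s).

Definition vf_smooth_at (X : TM -> E * E) (u : TM) : Prop :=
  forall c, in_atlas A c -> cdom c u.1 -> smooth_at (tm_coord c u) (vf_rep c X).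

Definition pi_field (s : TM -> E) : Prop := forall u, slit u -> pi_smooth_at s u.

Definition vector_field (X : TM -> E * E) : Prop :=
  forall u, slit u -> vf_smooth_at X u.

Definition lie_bracket (X Y : TM -> E * E) (u : TM) : E * E :=
  let c := chart_at A u.1 in
  'D_(X u) (vf_rep c Y) (tm_coord c u) - 'D_(Y u) (vf_rep c X) (tm_coord c u).

(* In induced coordinates d pi sends a^i d/dx^i + b^i d/dy^i to a^i d/dx^i, and
   the vertical lift at u of v is the velocity v^i d/dy^i of t |-> u + t v. *)
Definition rho (w : E * E) : E := w.1.
Definition gamma (v : E) : E * E := (0, v).

Definition eta (u : TM) : E := u.2.

(* The Finsler metric: half the fibre Hessian of L^2. *)
Definition metric (L : TM -> R) (u : TM) (v w : E) : R :=
  'D_v (fun y : E => 'D_w (fun y' : E => L (u.1, y') ^+ 2) y) u.2 / 2.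

Definition finsler (L : TM -> R) : Prop :=
  [/\ forall u, slit u -> fun_smooth_at L u,
      forall u, slit u -> 0 < L u,
      forall p (v : E) (a : R), 0 <= a -> L (p, a *: v) = a * L (p, v)
    & forall u, slit u -> forall v : E, v != 0 -> 0 < metric L u v v].

(* A linear connection on the pullback bundle, acting on tangent vectors and on
   local sections: [D u w s] is D_w s, for w tangent at u and s a section that is
   smooth near u. The Leibniz rule with f locally constant makes D_w s depend
   only on the germ of s at u. *)
Definition linear_connection (D : TM -> E * E -> (TM -> E) -> E) : Prop :=
  [/\ forall u (a : R) (w w' : E * E) (s : TM -> E), slit u -> pi_smooth_at s u ->
        D u (a *: w + w') s = a *: D u w s + D u w' s,
      forall u (w : E * E) (s t : TM -> E), slit u ->
        pi_smooth_at s u -> pi_smooth_at t u ->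
        D u w (fun q => s q + t q) = D u w s + D u w t,
      forall u (w : E * E) (f : TM -> R) (s : TM -> E), slit u ->
        fun_smooth_at f u -> pi_smooth_at s u ->
        D u w (fun q => f q *: s q) = tderive u w f *: s u + f u *: D u w s
    & forall u (X : TM -> E * E) (s : TM -> E), slit u ->
        vf_smooth_at X u -> pi_smooth_at s u ->
        pi_smooth_at (fun q => D q (X q) s) u].

Section Connection.
Variable D : TM -> E * E -> (TM -> E) -> E.

Definition nabla (X : TM -> E * E) (s : TM -> E) : TM -> E := fun u => D u (X u) s.

Definition conn_map (u : TM) (w : E * E) : E := D u w eta.

Definition regular : Prop := forall u, slit u ->
  (forall w, exists a b : E * E, [/\ rho a = 0, conn_map u b = 0 & w = a + b]) /\
  (forall w, rho w = 0 -> conn_map u w = 0 -> w = 0).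

(* the inverse of the restriction of rho to the kernel of the connection map *)
Definition beta (u : TM) (v : E) : E * E :=
  get [set w | conn_map u w = 0 /\ rho w = v].

Definition hlift (X : TM -> E) : TM -> E * E := fun u => beta u (X u).
Definition vlift (X : TM -> E) : TM -> E * E := fun u => gamma (X u).

Definition torsion (X Y : TM -> E * E) : TM -> E := fun u =>
  nabla X (rho \o Y) u - nabla Y (rho \o X) u - rho (lie_bracket X Y u).

Definition Qtor (X Y : TM -> E) : TM -> E := torsion (hlift X) (hlift Y).
Definition hvtor (X Y : TM -> E) : TM -> E := torsion (vlift X) (hlift Y).

Definition concurrent (zeta : TM -> E) : Prop :=
  pi_field zeta /\
  forall X : TM -> E, pi_field X -> forall u, slit u ->
    nabla (hlift X) zeta u = - X u /\ nabla (vlift X) zeta u = 0.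

(* the i-th coordinate vector field of the chart c, as a local pi-vector field *)
Definition frame (c : chart R n M) (i : 'I_n) : TM -> E :=
  fun q => vec_of c q.1 (delta_mx 0 i).

(* C(X) = Tr (Y |-> T(X, Y)): at u, the trace is computed in the coordinate
   frame of the preferred chart at u.1, where vectors are their own components *)
Definition Ctrace (X : TM -> E) (u : TM) : R :=
  \sum_(i < n) hvtor X (frame (chart_at A u.1) i) u 0 i.

Variable L : TM -> R.

Definition gprod (X Y : TM -> E) : TM -> R := fun u => metric L u (X u) (Y u).

Definition cartan_connection : Prop :=
  [/\ linear_connection D,
      regular,
      forall (X : TM -> E * E) (Y Z : TM -> E),
        vector_field X -> pi_field Y -> pi_field Z -> forall u, slit u ->
        tderive u (X u) (gprod Y Z) =
          gprod (nabla X Y) Z u + gprod Y (nabla X Z) u,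
      forall X Y : TM -> E, pi_field X -> pi_field Y ->
        forall u, slit u -> Qtor X Y u = 0
    & forall X Y Z : TM -> E, pi_field X -> pi_field Y -> pi_field Z ->
        forall u, slit u -> gprod (hvtor X Y) Z u = gprod (hvtor X Z) Y u].

Definition ell (X : TM -> E) : TM -> R := fun u => (L u)^-1 * gprod X eta u.

Definition cartan_tensor (X Y Z : TM -> E) : TM -> R := gprod (hvtor X Y) Z.

Definition nabla_cartan_tensor (V : TM -> E * E) (X Y Z : TM -> E) (u : TM) : R :=
  tderive u (V u) (cartan_tensor X Y Z)
  - cartan_tensor (nabla V X) Y Z u
  - cartan_tensor X (nabla V Y) Z u
  - cartan_tensor X Y (nabla V Z) u.

Definition nabla_Ctrace (V : TM -> E * E) (X : TM -> E) (u : TM) : R :=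
  tderive u (V u) (Ctrace X) - Ctrace (nabla V X) u.

Definition T_condition : Prop :=
  forall X Y Z W : TM -> E,
    pi_field X -> pi_field Y -> pi_field Z -> pi_field W ->
  forall u, slit u ->
    L u * nabla_cartan_tensor (vlift X) Y Z W u
    + (ell X u * cartan_tensor Y Z W u + ell Y u * cartan_tensor Z W X u
       + ell Z u * cartan_tensor W X Y u + ell W u * cartan_tensor X Y Z u) = 0.

Definition To_condition : Prop :=
  forall X Y : TM -> E, pi_field X -> pi_field Y ->
  forall u, slit u ->
    L u * nabla_Ctrace (vlift X) Y u
    + (ell X u * Ctrace Y u + ell Y u * Ctrace X u) = 0.

Definition hvtor_zero : Prop :=
  forall X Y : TM -> E, pi_field X -> pi_field Y ->
  forall u, slit u -> hvtor X Y u = 0.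

End Connection.

(* g(x, y) does not depend on y. This is equivalent to the vanishing of the
   torsion T (hvtor_zero) except for n = 1, where T vanishes identically but g may
   differ on the two half-lines of a slit tangent space. *)
Definition riemannian (L : TM -> R) : Prop :=
  forall (p : M) (y y' : E), y != 0 -> y' != 0 ->
  forall v w : E, metric L (p, y) v w = metric L (p, y') v w.

End TangentBundle.

(* Main.v *)
From HB Require Import structures.
Require Import Defs.
From mathcomp Require Import all_boot all_order all_algebra.
From mathcomp Require Import all_classical all_reals all_analysis.
From mathcomp Require Import ring lra.

(** A concurrent field lives on the whole slit tangent bundle, and this already
forces the torsion [T] to vanish: all the conditions that are compared hold.

Write [u = (p, y)], and let [G(b, a)] be the derivative, in the vertical
direction [b], of a section that is constantly [a] along the fibre over [p]
([vert_coeff]). Global fields with prescribed values over [p]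
([prescribed_fields]) turn the axioms of the Cartan connection into identities
between vectors at a point. Metricity and the symmetry of [T] give
[D_b g(a, e) = 2 g(G(b, a), e)] ([derive_metric]), so [4 g(G(b, a), e)] is a
third derivative of [L^2] along the fibre: it is symmetric in [a, b, e],
homogeneous of degree [-1], and vanishes when one argument is [y].

Let now [zeta] be concurrent. The function [g(zeta, zeta)] has vertical
derivative [0] ([norm_vert]), and its derivative along any lift of [a] is
[-2 g(a, zeta)] ([norm_horiz]). A function that is constant along the fibres has
a differential with the same property, hence [g(a, zeta)] is constant along the
fibre ([zeta_form_segment]); differentiating it vertically yields
[g(G(b, a), zeta) = 0] ([vert_coeff_zeta]), thus [G(b, zeta) = 0], and the
components of [zeta] are constant along the fibre ([zeta_vert]).

It follows that [G = 0] ([vert_coeff_vanish]). If [zeta] vanishes at [u],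
differentiate [g(G(b, a), zeta) = 0] in a direction [e] of the base: as the
derivative of [zeta] is [-e], this gives [g(G(b, a), e) = 0]. Otherwise let [r]
be [zeta(u)] or its opposite, the sign being such that the ray [y + t r],
[t >= 0], avoids the origin. Third derivatives of [L^2] with one argument [zeta]
vanish, so by symmetry every third derivative is constant along the ray, while
by homogeneity it decays like [1/t] there: it is zero.

When [G = 0], the vertical derivative of a section is the derivative of its
components, which the bracket in the torsion cancels: [T = 0]
([hvtor_vanish]). Moreover the Hessian of [L^2] is constant along segments of a
fibre that avoid the origin, and for [n <> 1] two such segments are enough to
join any two nonzero vectors ([riemannian_vanish]). *)

Set Implicit Arguments.
Unset Strict Implicit.
Unset Printing Implicit Defensive.

Import Order.TTheory GRing.Theory Num.Theory.
Import numFieldNormedType.Exports.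

Local Open Scope classical_set_scope.
Local Open Scope ring_scope.

(** * Directional derivatives *)

(** A finite basis whose coordinate functions are continuous. As a class it
covers scalars, row vectors and products at once, so that one notion of
smoothness serves the charts of a manifold and those of its tangent bundle. *)
Class coordinates (R : realType) (V : normedModType R) := Coordinates {
  coord_dim : nat;
  coord_vec : 'I_coord_dim -> V;
  coord_fun : 'I_coord_dim -> {linear V -> R};
  coord_fun_cont : forall i, continuous (coord_fun i);
  coord_decomp : forall v, v = \sum_i coord_fun i v *: coord_vec i }.

Lemma near_comp (T U : topologicalType) (g : T -> U) (x : T) (y : U) (P : U -> Prop) :
  g z @[z --> x] --> y -> (\forall z \near y, P z) -> \forall z \near x, P (g z).
Proof. by move=> gy Py; exact: gy. Qed.

Lemma open_preimage_on (T T' : topologicalType) (U : set T) (V : set T') (f : T -> T') :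
  open U -> open V -> (forall x, U x -> {for x, continuous f}) ->
  open (U `&` f @^-1` V).
Proof.
move=> oU oV fc; rewrite openE => x [Ux Vx]; rewrite /interior.
apply: filterI; first exact: open_nbhs_nbhs.
by apply: (fc x Ux); exact: open_nbhs_nbhs.
Qed.

Section DirectionalDerivative.
Context {R : realType}.
Implicit Types V W : normedModType R.

Lemma is_derive_lin_comp V W W' (l : {linear W -> W'}) (f : V -> W) x v df :
  continuous l -> is_derive x v f df -> is_derive x v (l \o f) (l df).
Proof.
move=> lc [fd fE].
have h : (fun h => h^-1 *: (((l \o f) \o shift x) (h *: v) - (l \o f) x)) @ 0^'
    --> l df.
  have fl : (fun h => h^-1 *: ((f \o shift x) (h *: v) - f x)) @ 0^' --> df.
    by rewrite -fE; exact: fd.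
  have := cvg_comp _ _ fl (lc df); rewrite [X in X @ _ --> _ -> _](_ : _ =
    (fun h => h^-1 *: (((l \o f) \o shift x) (h *: v) - (l \o f) x)))//.
  by apply: funext => h /=; rewrite linearZZ linearB.
by split; [apply/cvg_ex; exists (l df) | exact/cvg_lim].
Qed.

(** The first-order estimate spares the division by [h], hence the case
distinction at [h = 0]. *)
Lemma is_deriveP V W (f : V -> W) x v df : is_derive x v f df <->
  forall e, 0 < e -> \forall h \near (0 : R),
    `|f (h *: v + x) - f x - h *: df| <= e * `|h|.
Proof.
split=> [[fd <-] e e0|fe].
  have /derivable_nbhs/eqaddoP/(_ _ e0) := fd.
  apply: filterS => h /=; congr (_ <= _).
  by rewrite opprD addrA.
have h : (fun h => h^-1 *: ((f \o shift x) (h *: v) - f x)) @ 0^' --> df.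
  apply/cvgrPdist_le => e e0; near=> h.
  have h0 : h != 0 by near: h; exact: nbhs_dnbhs_neq.
  rewrite -[df](scalerK h0) -scalerBr normrZ normfV ler_pdivrMl ?normr_gt0//.
  rewrite distrC /= mulrC; near: h; apply: nbhs_dnbhs; exact: fe.
by split; [apply/cvg_ex; exists df | exact/cvg_lim].
Unshelve. all: by end_near. Qed.

Lemma is_derive_dir V W (f : V -> W) x v df (c : R) :
  is_derive x v f df -> is_derive x (c *: v) f (c *: df).
Proof.
move=> /is_deriveP fd; apply/is_deriveP => e e0.
have c1 : 0 < `|c| + 1 by rewrite ltr_wpDl.
have hc : (fun h => h * c) @ (0 : R) --> (0 : R).
  by rewrite -[X in _ --> X](mul0r c); exact: mulrr_continuous.
apply: filterS (near_comp hc (fd _ (divr_gt0 e0 c1))) => h.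
rewrite !scalerA => /le_trans; apply.
rewrite normrM mulrCA [leRHS]mulrC ler_wpM2l// mulrAC ler_pdivrMr//.
by rewrite ler_wpM2l ?(ltW e0)// lerDl.
Qed.

Lemma is_derive_dir0 V W (f : V -> W) (x v : V) (c : R) :
  derivable f x v -> 'D_v f x = 0 -> is_derive x (c *: v) f 0.
Proof. by move=> /derivableP/(is_derive_dir c) + f0; rewrite f0 scaler0. Qed.

(** A directional derivative depends on the restriction of the function to a
line only, which relates derivatives of functions with different domains. *)
Lemma derive_along V V' W (f : V -> W) (g : V' -> W)
    (x v : V) (x' v' : V') :
  (forall h : R, f (h *: v + x) = g (h *: v' + x')) -> 'D_v f x = 'D_v' g x'.
Proof.
move=> fg; have fgx : f x = g x' by have := fg 0; rewrite !scale0r !add0r.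
have FG : (fun h : R => h^-1 *: ((f \o shift x) (h *: v) - f x)) =
    (fun h : R => h^-1 *: ((g \o shift x') (h *: v') - g x')).
  by apply/funext => h; rewrite /= fg fgx.
by rewrite /derive FG.
Qed.

Lemma near_line V (v x : V) (P : V -> Prop) :
  (\forall z \near x, P z) -> \forall h \near (0 : R), P (h *: v + x).
Proof.
move=> Px; have cx : h *: v + x @[h --> (0 : R)] --> x.
  rewrite -[X in _ --> X]add0r -[X in _ --> X + _](scale0r v).
  by apply: cvgD; [exact: scalel_continuous | exact: cvg_cst].
exact: near_comp cx Px.
Qed.

Lemma derive0_line V (f : V -> R) (x v : V) :
  (\forall h \near (0 : R), f (h *: v + x) = 0) -> 'D_v f x = 0.
Proof.
move=> fv; have f0 : f x = 0 by have := nbhs_singleton fv; rewrite scale0r add0r.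
suff [] : is_derive x v f 0 by [].
apply/is_deriveP => e e0; apply: filterS fv => h ->.
rewrite f0 subrr sub0r normrN (_ : h *: 0 = 0) ?normr0 ?mulr_ge0 ?(ltW e0)//.
exact: mulr0.
Qed.

Lemma mean_value_dir V (f : V -> R) x v :
  (forall t, 0 <= t <= 1 -> derivable f (x + t *: v) v) ->
  exists2 t, 0 < t < 1 & f (x + v) - f x = 'D_v f (x + t *: v).
Proof.
move=> fd.
have gd (t : R) : 0 <= t <= 1 ->
    is_derive t 1 (fun t => f (x + t *: v)) ('D_v f (x + t *: v)).
  move=> /fd/derivableP/is_deriveP tP; apply/is_deriveP => e /tP.
  by apply: filterS => h; rewrite [_%:A]mulr1 scalerDl addrCA.
have [||t] := @MVT R (fun t => f (x + t *: v)) (fun t => 'D_v f (x + t *: v))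
   0 1 ltr01.
- by move=> t; rewrite in_itv /= => /andP[t0 t1]; apply: gd; rewrite !ltW.
- apply: derivable_within_continuous => t; rewrite in_itv /= => tP.
  by case: (gd t tP).
rewrite in_itv /= => tP; rewrite scale1r scale0r addr0 subr0 mulr1 => tE.
by exists t.
Qed.

Lemma constant_dir V (f : V -> R) x v :
  (forall t, 0 <= t <= 1 -> is_derive (x + t *: v) v f 0) -> f (x + v) = f x.
Proof.
move=> fd.
have [t /fd[]//|t /andP[t0 t1] tE] := @mean_value_dir V f x v.
have [|_ t'] := fd t; first by rewrite !ltW.
by apply/eqP; rewrite -subr_eq0 tE t'.
Qed.

(** The mean value theorem turns continuity of one directional derivative into
additivity in the direction: [f (x + h v + h w) - f (x + h v)] is [h] times
[D_w f] at a point close to [x]. *)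
Lemma deriveD_dir V (f : V -> R) x v w :
  derivable f x v -> (\forall y \near x, derivable f y w) ->
  {for x, continuous ('D_w f)} ->
  is_derive x (v + w) f ('D_v f x + 'D_w f x).
Proof.
move=> /derivableP/is_deriveP fv fw cw; apply/is_deriveP => e e0.
have e20 : 0 < e / 2 by rewrite divr_gt0.
have {}cw : \forall y \near x, `|'D_w f x - 'D_w f y| <= e / 2.
  by move/cvgrPdist_le : cw; exact.
have /nbhs_normP[d /= d0 xd] : \forall y \near x, derivable f y w /\
    `|'D_w f x - 'D_w f y| <= e / 2 by apply: filterI.
have nd : \forall h \near (0 : R), `|h| * (`|v| + `|w|) < d.
  have : (fun h : R => `|h| * (`|v| + `|w|)) @ (0 : R) --> (0 : R).
    rewrite -[X in _ --> X](mul0r (`|v| + `|w|)); apply: cvgMr_tmp.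
    by rewrite -[X in _ --> X](normr0 R); exact: norm_continuous.
  by move=> /cvgrPdist_lt/(_ _ d0); apply: filterS => h; rewrite sub0r normrN;
    apply: le_lt_trans; exact: ler_norm.
apply: filterS2 (fv _ e20) nd => h hv hd.
have inball (t : R) : 0 <= t <= 1 -> ball_ Num.norm x d (h *: v + x + t *: (h *: w)).
  move=> /andP[t0 t1]; rewrite /ball_ /= (le_lt_trans _ hd)// distrC.
  rewrite addrAC addrK (le_trans (ler_normD _ _))// !normrZ mulrDr lerD2l.
  by rewrite ger0_norm// ler_piMl// mulr_ge0.
have [t /inball/xd[/derivableP/(is_derive_dir h)[]//]|t /andP[t0 t1] tE] :=
  @mean_value_dir V f (h *: v + x) (h *: w).
have /inball/xd[/derivableP/(is_derive_dir h)[_ tD] tc] : 0 <= t <= 1 by rewrite !ltW.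
rewrite tD in tE.
rewrite [h *: (v + w)]scalerDr [h *: ('D_v f x + _)]scalerDr [_ + _ + x]addrAC.
rewrite (_ : _ - _ - _ = (f (h *: v + x) - f x - h *: 'D_v f x)
  + (f (h *: v + x + h *: w) - f (h *: v + x) - h *: 'D_w f x)); last by ring.
rewrite (le_trans (ler_normD _ _))// tE -scalerBr normrZ (splitr e) mulrDl.
by rewrite lerD// mulrC ler_wpM2r// distrC.
Qed.

Lemma near_neq0 V (v : V) :
  v != 0 -> \forall y \near v, y != 0.
Proof.
rewrite -normr_gt0 => v0.
have : \forall y \near v, ball_ Num.norm v `|v| y by apply/nbhs_normP; exists `|v|.
apply: filterS => y; rewrite /ball_ /=; apply: contraTneq => ->.
by rewrite subr0 ltxx.
Qed.

Lemma segment_neq0 V (y b : V) : y != 0 ->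
  \forall h \near (0 : R), forall t : R, 0 <= t <= 1 -> y + t *: (h *: b) != 0.
Proof.
move=> y0; have b1 : 0 < `|b| + 1 by rewrite ltr_wpDl.
have : \forall h \near (0 : R), `|h| < `|y| / (`|b| + 1).
  by apply: nbhs0_lt; rewrite divr_gt0 ?normr_gt0.
apply: filterS => h; rewrite ltr_pdivlMr// => hy t /andP[t0 t1].
rewrite addrC addr_eq0; apply: contraTneq hy => yE.
rewrite -leNgt -[y]opprK -yE normrN !normrZ (ger0_norm t0).
by rewrite (le_trans (ler_piMl _ t1)) ?mulr_ge0// ler_wpM2l// lerDl.
Qed.

(** The line through [y] in direction [v] meets the origin at most once, so that
one of its two halves starting at [y] avoids it. *)
Lemma ray_exists V (y v : V) : y != 0 -> v != 0 -> exists2 r, r = v \/ r = - v &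
  forall t : R, 0 <= t -> y + t *: r != 0.
Proof.
move=> y0 v0; have [[t0 t00 yE]|nE] := pselect (exists2 t : R, 0 <= t & y + t *: v = 0).
  exists (- v); first by right.
  move=> t t0'; have -> : y = - (t0 *: v) by apply/eqP; rewrite -addr_eq0 yE.
  rewrite scalerN -opprD -scalerDl oppr_eq0 scaler_eq0 negb_or v0 andbT.
  rewrite paddr_eq0// negb_and; apply/orP; left.
  by apply: contra_neq y0 => t0E; rewrite -yE t0E scale0r addr0.
exists v; first by left.
by move=> t t0; apply/eqP => yE; apply: nE; exists t.
Qed.

(** The differential is chosen among the continuous linear maps with the
first-order property, so it is enough to exhibit one. *)
Lemma differentiable_approx V W (f : V -> W) (df : {linear V -> W}) x :
  continuous df ->
  (forall e, 0 < e -> \forall h \near (0 : V),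
     `|f (h + x) - f x - df h| <= e * `|h|) ->
  differentiable f x.
Proof.
move=> dfc fdf; apply/diffP => /=.
apply: (@getPex _ (fun (df : {linear V -> W}) => continuous df /\
  forall y, f y = f (lim (nbhs x)) + df (y - lim (nbhs x))
                  +o_(y \near x) (y - lim (nbhs x)))).
have fo : f = (fun y => f x + df (y - x)) +o_ x (center x).
  apply/eqaddoP => e e0.
  have yx : (fun y => y - x) @ x --> (0 : V).
    by rewrite -[X in _ --> X](subrr x); apply: cvgB; [exact: cvg_id | exact: cvg_cst].
  apply: filterS (near_comp yx (fdf _ e0)) => y /=.
  by rewrite subrK opprD addrA.
exists df; split=> //; apply: eqaddoEx => y.
by rewrite lim_id// {1}fo.
Qed.

Lemma continuous_sum V W (I : Type) (r : seq I) (F : I -> V -> W) x :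
  (forall i, {for x, continuous (F i)}) ->
  {for x, continuous (fun v => \sum_(i <- r) F i v)}.
Proof.
move=> Fc; rewrite /prop_for /continuous_at; elim: r => [|i r IH].
  by rewrite big_nil; under eq_fun do rewrite big_nil; exact: cvg_cst.
by rewrite big_cons; under eq_fun do rewrite big_cons; apply: cvgD => //; exact: Fc.
Qed.

Lemma coord_fun_lipschitz V (cV : coordinates V) i :
  exists2 k, 0 < k & forall v, `|coord_fun i v| <= k * `|v|.
Proof. by have [k k0 kP] := linear_lipschitz (coord_fun_cont (i:=i)); exists k. Qed.

Lemma derive_coord_fun V W (cW : coordinates W) (f : V -> W) x v i :
  derivable f x v -> 'D_v (coord_fun i \o f) x = coord_fun i ('D_v f x).
Proof.
by move=> /derivableP fd; have [] := is_derive_lin_comp (coord_fun_cont (i:=i)) fd.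
Qed.

(** The increment of [f] from [x] to [x + h] is [D_h f] at a point of the
segment; additivity in the direction expresses it by the derivatives along the
basis, whose continuity at [x] gives the first-order estimate. *)
Lemma differentiable_c1 V (cV : coordinates V) (f : V -> R) (U : set V) x :
  open U ->
  (forall y, U y -> forall v, derivable f y v /\ {for y, continuous ('D_v f)}) ->
  U x -> differentiable f x.
Proof.
move=> oU fU Ux.
have fdir y : U y -> forall v, 'D_v f y = \sum_i coord_fun i v * 'D_(coord_vec i) f y.
  move=> Uy v; rewrite {1}(coord_decomp v).
  have nU : \forall z \near y, U z by exact: open_nbhs_nbhs.
  have sumP (I : Type) (r : seq I) (c : I -> R) (e : I -> V) :
      is_derive y (\sum_(i <- r) c i *: e i) f (\sum_(i <- r) c i * 'D_(e i) f y).
    elim: r => [|i r IH]; first by rewrite !big_nil; exact: is_derive0.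
    rewrite !big_cons; case: IH => dr <-.
    have /derivableP/(is_derive_dir (c i))[_] := (fU _ Uy (e i)).1.
    rewrite -[c i * _]/(c i *: _) => <-.
    apply: deriveD_dir; first exact: (fU _ Uy _).1.
      by apply: filterS nU => z Uz; exact: (fU _ Uz _).1.
    exact: (fU _ Uy _).2.
  by have [] := sumP _ (index_enum 'I_coord_dim) (coord_fun ^~ v) coord_vec.
pose df v := \sum_(i < @coord_dim _ _ cV) coord_fun i v * 'D_(coord_vec i) f x.
have dfl : linear df.
  move=> a u v; rewrite /df scaler_sumr -big_split /=; apply: eq_bigr => i _.
  by rewrite linearP mulrDl scalerAl.
pose dF : {linear V -> R} := HB.pack df (GRing.isLinear.Build R V R *:%R df dfl).
have /cid2[k k0 kP] : exists2 k, 0 < k & forall i (v : V), `|coord_fun i v| <= k * `|v|.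
  pose k (i : 'I_(@coord_dim _ _ cV)) := s2val (cid2 (coord_fun_lipschitz (cV := cV) i)).
  have kP i : 0 < k i /\ forall v, `|coord_fun i v| <= k i * `|v|.
    by rewrite /k; case: cid2.
  exists (1 + \sum_i k i) => [|i v].
    by rewrite ltr_pwDl// sumr_ge0// => i _; rewrite ltW// (kP i).1.
  apply: le_trans ((kP i).2 v) _; rewrite ler_wpM2r// (bigD1 i)//= addrCA lerDl.
  by rewrite addr_ge0// sumr_ge0// => j _; rewrite ltW// (kP j).1.
apply: (@differentiable_approx _ _ _ dF) => [|e e0] /=.
  move=> v; apply: continuous_sum => i.
  by apply: cvgMr_tmp; exact: coord_fun_cont.
(* The tolerance for each partial derivative; the successor avoids a division
   by zero in dimension zero. *)
pose m := @coord_dim _ _ cV; pose e' := e / (k * m.+1%:R).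
have e'0 : 0 < e' by rewrite divr_gt0// mulr_gt0.
have nD : \forall y \near x, U y /\ forall i : 'I_coord_dim,
    `|'D_(coord_vec i) f x - 'D_(coord_vec i) f y| <= e'.
  near=> y; split; first by near: y; exact: open_nbhs_nbhs.
  near: y; apply: filter_forall => i.
  by have /cvgrPdist_le := (fU _ Ux (coord_vec i)).2; exact.
have /nbhs_normP[d /= d0 xd] := nD.
near=> h.
have hd : `|h| < d by near: h; exact: nbhs0_lt.
have inball (t : R) : 0 <= t <= 1 -> ball_ Num.norm x d (x + t *: h).
  move=> /andP[t0 t1]; rewrite /ball_ /= opprD addNKr normrN normrZ.
  by rewrite (le_lt_trans _ hd)// ger0_norm// ler_piMl.
have [t /inball/xd[Uy _]|t /andP[t0 t1] tE] := @mean_value_dir V f x h.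
  exact: (fU _ Uy _).1.
have /inball/xd[Uy tD] : 0 <= t <= 1 by rewrite !ltW.
rewrite [h + x]addrC tE fdir// /df -sumrB.
apply: le_trans (ler_norm_sum _ _ _) _.
apply: (@le_trans _ _ (\sum_(i < coord_dim) (k * `|h|) * e')).
  apply: ler_sum => i _; rewrite -mulrBr normrM ler_pM//.
  by rewrite distrC tD.
rewrite sumr_const card_ord -mulr_natr /e' mulrAC.
rewrite -/m [leLHS](_ : _ = e * `|h| * (m%:R / m.+1%:R)).
  by rewrite ler_piMr ?mulr_ge0 ?(ltW e0)// ler_pdivrMr// mul1r ler_nat.
have q0 : (m.+1%:R : R) != 0 by rewrite pnatr_eq0.
by move: (m.+1%:R : R) q0 => q q0; field; rewrite q0 gt_eqF.
Unshelve. all: by end_near. Qed.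
End DirectionalDerivative.

(** * Coordinate functions on row vectors and on products *)

Lemma coord_rV_linear {R : realType} n (i : 'I_n) :
  linear (fun v : 'rV[R]_n => v 0 i : R).
Proof. by move=> a u v; rewrite !mxE. Qed.

Definition coord_rV {R : realType} n (i : 'I_n) : {linear 'rV[R]_n -> R} :=
  HB.pack (fun v : 'rV[R]_n => v 0 i : R)
    (GRing.isLinear.Build R 'rV[R]_n R *:%R _ (coord_rV_linear i)).

#[global] Instance coordinates_rV {R : realType} n : coordinates 'rV[R]_n.
Proof.
apply: (@Coordinates _ _ n (delta_mx 0) (@coord_rV R n)) => [i v|v].
  exact: coord_continuous.
exact: row_sum_delta.
Defined.

Lemma coord_rV_cont {R : realType} n (i : 'I_n) : continuous (@coord_rV R n i).
Proof. by move=> v; exact: coord_continuous. Qed.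

Lemma linear_expand {R : realType} n (f : 'rV[R]_n -> R) v : linear f ->
  f v = \sum_i v 0 i * f (delta_mx 0 i).
Proof.
move=> lf; pose g : {linear 'rV[R]_n -> R} := HB.pack f
  (GRing.isLinear.Build R 'rV[R]_n R *:%R _ lf).
rewrite -[LHS]/(g v) {1}(row_sum_delta v) linear_sum; apply: eq_bigr => i _.
by rewrite linearZ.
Qed.

Lemma pair1_linear {R : realType} (V W : normedModType R) :
  linear (fun z : V * W => z.1).
Proof. by []. Qed.
Lemma pair2_linear {R : realType} (V W : normedModType R) :
  linear (fun z : V * W => z.2).
Proof. by []. Qed.
Definition pair1 {R : realType} (V W : normedModType R) : {linear (V * W)%type -> V} :=
  HB.pack (fun z : V * W => z.1)
    (GRing.isLinear.Build R (V * W)%type V *:%R _ (@pair1_linear R V W)).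
Definition pair2 {R : realType} (V W : normedModType R) : {linear (V * W)%type -> W} :=
  HB.pack (fun z : V * W => z.2)
    (GRing.isLinear.Build R (V * W)%type W *:%R _ (@pair2_linear R V W)).

Lemma derive_pair1 {R : realType} (V W W' : normedModType R) (f : V -> W * W') (z v : V) :
  derivable f z v -> ('D_v f z).1 = 'D_v (fst \o f) z.
Proof.
move=> fd; have lc : continuous (pair1 W W') by move=> x; exact: cvg_fst.
by have [_] := is_derive_lin_comp lc (derivableP fd).
Qed.

Section CoordinatesPair.
Context {R : realType} {V W : normedModType R}.
Context (cV : coordinates V) (cW : coordinates W).

Let pair_vec (i : 'I_(@coord_dim _ _ cV + @coord_dim _ _ cW)) : V * W :=
  match fintype.split i with
  | inl j => (coord_vec j, 0) | inr j => (0, coord_vec j) end.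

Let pair_fun (i : 'I_(@coord_dim _ _ cV + @coord_dim _ _ cW)) :
    {linear (V * W)%type -> R} :=
  match fintype.split i with
  | inl j => coord_fun j \o pair1 V W | inr j => coord_fun j \o pair2 V W end.

#[global] Instance coordinates_pair : coordinates (V * W)%type.
Proof.
apply: (@Coordinates _ _ _ pair_vec pair_fun) => [i z|[v w]].
  rewrite /pair_fun; case: (fintype.split i) => j; apply: continuous_comp.
  - exact: cvg_fst.
  - exact: coord_fun_cont.
  - exact: cvg_snd.
  - exact: coord_fun_cont.
rewrite big_split_ord /=.
have -> : (v, w) = (v, 0) + (0, w) :> V * W.
  by congr pair; rewrite ?addr0 ?add0r.
congr (_ + _).
  rewrite {1}(coord_decomp v).
  rewrite (big_morph (fun v : V => (v, 0 : W)) (id1 := 0) (op1 := +%R))//; last first.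
    by move=> x y; congr pair; rewrite addr0.
  apply: eq_bigr => i _; rewrite /pair_fun /pair_vec (unsplitK (inl i)) /= addr0.
  by congr pair; rewrite scaler0.
rewrite {1}(coord_decomp w).
rewrite (big_morph (fun w : W => (0 : V, w)) (id1 := 0) (op1 := +%R))//; last first.
  by move=> x y; congr pair; rewrite addr0.
apply: eq_bigr => i _; rewrite /pair_fun /pair_vec (unsplitK (inr i)) /= add0r.
by congr pair; rewrite scaler0.
Defined.

End CoordinatesPair.

#[global] Instance coordinates_real {R : realType} : coordinates R.
Proof.
apply: (@Coordinates R R 1 (fun=> 1 : R) (fun=> idfun : {linear R -> R})) => [i x //|x].
by rewrite big_ord1 /= [RHS]mulr1.
Defined.

(** * Smooth maps *)

Section SmoothClass.
Context {R : realType}.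
Implicit Types V W : normedModType R.

Lemma differentiableE V W (f : V -> W) x : differentiable f x ->
  forall e, 0 < e -> \forall h \near (0 : V),
    `|f (h + x) - f x - 'd f x h| <= e * `|h|.
Proof.
move=> /diff_locally/eqaddoP fd e /fd; apply: filterS => h /=.
by rewrite opprD addrA.
Qed.

Lemma near_eq_differentiable V W (f g : V -> W) x :
  (\forall y \near x, f y = g y) -> differentiable f x -> differentiable g x.
Proof.
move=> fg fd; apply: (@differentiable_approx _ _ _ _ ('d f x)).
  exact: diff_continuous.
move=> e e0.
have hx : (fun h => h + x) @ (0 : V) --> x.
  by rewrite -[X in _ --> X]add0r; apply: cvgD; [exact: cvg_id | exact: cvg_cst].
apply: filterS2 (differentiableE fd e0) (near_comp hx fg) => h + fgh.
by rewrite fgh (nbhs_singleton fg).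
Qed.

Lemma chain_rule V V' W (f : V' -> W) (g : V -> V') x v :
  differentiable g x -> differentiable f (g x) ->
  'D_v (f \o g) x = 'D_('D_v g x) f (g x).
Proof.
move=> gd fd; rewrite (deriveE _ (differentiable_comp gd fd)).
by rewrite (deriveE _ fd) (deriveE _ gd) (diff_comp gd fd).
Qed.

(** Iterated directional derivatives do not compose; total differentiability at
every order does. This intermediate class allows induction on the order. *)
Fixpoint Ck k V W (U : set V) (f : V -> W) : Prop :=
  (forall x, U x -> differentiable f x) /\
  (if k is k'.+1 then forall v, Ck k' U ('D_v f) else True).

Lemma Ck_diff k V W (U : set V) (f : V -> W) x :
  Ck k U f -> U x -> differentiable f x.
Proof. by case: k => [|k] [fd _]; exact: fd. Qed.

Lemma Ck_weak k V W (U : set V) (f : V -> W) : Ck k.+1 U f -> Ck k U f.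
Proof.
by elim: k f => [|k IH] f [fd fD]; split=> // v; apply: IH; exact: fD.
Qed.

Lemma Ck_eq k V W (U : set V) (f g : V -> W) :
  open U -> (forall x, U x -> f x = g x) -> Ck k U f -> Ck k U g.
Proof.
move=> oU; have nearU (f' g' : V -> W) : (forall x, U x -> f' x = g' x) ->
    forall x, U x -> \forall y \near x, f' y = g' y.
  by move=> fg x Ux; apply: filterS fg _; exact: open_nbhs_nbhs.
elim: k f g => [|k IH] f g fg [fd fD].
  by split=> // x Ux; apply: near_eq_differentiable (fd _ Ux); exact: nearU.
split=> [x Ux|v].
  by apply: near_eq_differentiable (fd _ Ux); exact: nearU.
by apply: IH (fD v) => x Ux; apply: near_eq_derive; exact: nearU.
Qed.

Lemma Ck_cst k V W (U : set V) (c : W) : Ck k U (fun _ : V => c).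
Proof.
elim: k c => [|k IH] c; first by split=> // x _; exact: differentiable_cst.
split=> [x _|v]; first exact: differentiable_cst.
rewrite (_ : derive _ ^~ v = fun=> 0); first exact: IH.
by apply/funext => x; exact: derive_cst.
Qed.

Lemma Ck_lin k V W (U : set V) (l : {linear V -> W}) :
  continuous l -> Ck k U l.
Proof.
move=> lc; have ld x : differentiable l x by exact: linear_differentiable.
case: k => [|k]; split=> // v.
rewrite (_ : derive _ ^~ v = fun=> l v); first exact: Ck_cst.
by apply/funext => x; rewrite deriveE// diff_lin.
Qed.

Lemma Ck_add k V W (U : set V) (f g : V -> W) : open U ->
  Ck k U f -> Ck k U g -> Ck k U (fun x => f x + g x).
Proof.
move=> oU; elim: k f g => [|k IH] f g [fd fD] [gd gD].
  by split=> // x Ux; apply: differentiableD; [exact: fd|exact: gd].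
split=> [x Ux|v]; first by apply: differentiableD; [exact: fd|exact: gd].
apply: Ck_eq (IH _ _ (fD v) (gD v)) => // x Ux; apply/esym.
by apply: deriveD; apply: diff_derivable; [exact: fd|exact: gd].
Qed.

Lemma Ck_sum k V W (U : set V) (I : Type) (r : seq I) (F : I -> V -> W) :
  open U -> (forall i, Ck k U (F i)) -> Ck k U (fun x => \sum_(i <- r) F i x).
Proof.
move=> oU FC; elim: r => [|i r IH].
  by under eq_fun do rewrite big_nil; exact: Ck_cst.
by under eq_fun do rewrite big_cons; exact: Ck_add.
Qed.

Lemma Ck_mul k V (U : set V) (f g : V -> R) : open U ->
  Ck k U f -> Ck k U g -> Ck k U (fun x => f x * g x).
Proof.
move=> oU; elim: k f g => [|k IH] f g fC gC.
  by split=> // x Ux; apply: differentiableM; [exact: fC.1|exact: gC.1].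
have [fd fD] := fC; have [gd gD] := gC.
split=> [x Ux|v]; first by apply: differentiableM; [exact: fd|exact: gd].
have := Ck_add oU (IH _ _ (Ck_weak fC) (gD v)) (IH _ _ (Ck_weak gC) (fD v)).
apply: Ck_eq => // x Ux; apply/esym.
by apply: deriveM; apply: diff_derivable; [exact: fd|exact: gd].
Qed.

Lemma differentiable_coordP V W (cW : coordinates W) (f : V -> W) x :
  (forall i, differentiable (coord_fun i \o f) x) -> differentiable f x.
Proof.
move=> fd; rewrite (_ : f = \sum_i (fun y => (coord_fun i \o f) y *: coord_vec i)).
  apply: differentiable_sum => i.
  exact: (@differentiableZl _ _ _ (coord_fun i \o f) (coord_vec i)).
by apply/funext => y; rewrite fct_sumE -coord_decomp.
Qed.

Lemma differentiable_scale V W (cW : coordinates W)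
    (f : V -> R) (g : V -> W) x :
  differentiable f x -> differentiable g x -> differentiable (fun y => f y *: g y) x.
Proof.
move=> fd gd; apply: differentiable_coordP => i.
rewrite (_ : _ \o _ = f * (coord_fun i \o g)); last first.
  by apply/funext => y /=; rewrite linearZ.
apply: differentiableM => //; apply: differentiable_comp => //.
by apply: linear_differentiable; exact: coord_fun_cont.
Qed.

Lemma Ck_coordP k V W (cW : coordinates W) (U : set V) (f : V -> W) : open U ->
  Ck k U f <-> forall i, Ck k U (coord_fun i \o f).
Proof.
move=> oU; split.
  have ld (h : V -> W) x i : differentiable h x -> differentiable (coord_fun i \o h) x.
    move=> hd; apply: differentiable_comp => //.
    by apply: linear_differentiable; exact: coord_fun_cont.
  elim: k f => [|k IH] f [fd fD] i.
    by split=> // x Ux; apply: ld; exact: fd.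
  split=> [x Ux|v]; first by apply: ld; exact: fd.
  apply: Ck_eq (IH _ (fD v) i) => // x Ux; apply/esym; rewrite derive_coord_fun//.
    by apply: diff_derivable; exact: fd.
elim: k f => [|k IH] f fC.
  by split=> // x Ux; apply: differentiable_coordP => i; exact: Ck_diff (fC i) Ux.
have fd x : U x -> differentiable f x.
  by move=> Ux; apply: differentiable_coordP => i; exact: Ck_diff (fC i) Ux.
split=> // v; apply: IH => i; have [_ /(_ v)] := fC i.
apply: Ck_eq => // x Ux; rewrite derive_coord_fun//.
by apply: diff_derivable; exact: fd.
Qed.

(** The derivative of [f \o g] in direction [v] is the sum over [j] of
[(D_v g)_j] times [(D_j f) \o g], whose factors have one order less. *)
Lemma Ck_comp k V V' W (cV' : coordinates V') (cW : coordinates W)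
    (U : set V) (U' : set V') (f : V' -> W) (g : V -> V') :
  open U -> open U' -> (forall x, U x -> U' (g x)) ->
  Ck k U' f -> Ck k U g -> Ck k U (f \o g).
Proof.
move=> oU oU' UU'; elim: k W cW f g UU' => [|k IH] W cW f g UU' fC gC.
  split=> // x Ux; apply: differentiable_comp; first exact: Ck_diff gC Ux.
  exact: Ck_diff fC (UU' _ Ux).
have dfg x : U x -> differentiable (f \o g) x.
  move=> Ux; apply: differentiable_comp; first exact: Ck_diff gC Ux.
  exact: Ck_diff fC (UU' _ Ux).
split=> // v; apply/Ck_coordP => // i.
pose Dg (j : 'I_(@coord_dim _ _ cV')) x := coord_fun j ('D_v g x).
pose Df (j : 'I_(@coord_dim _ _ cV')) := coord_fun i \o 'D_(coord_vec j) f.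
have : Ck k U (fun x => \sum_j Dg j x * (Df j \o g) x).
  apply: Ck_sum => // j; apply: Ck_mul => //.
    by move: j; apply/Ck_coordP => //; exact: gC.2.
  apply: IH => //; last exact: Ck_weak.
  by apply: (Ck_coordP k cW ('D_(coord_vec j) f) oU').1; exact: fC.2.
apply: Ck_eq => // x Ux /=.
have fd : differentiable f (g x) := Ck_diff fC (UU' _ Ux).
have gd : differentiable g x := Ck_diff gC Ux.
rewrite (chain_rule v gd fd) [in RHS](coord_decomp ('D_v g x)) (deriveE _ fd).
rewrite !linear_sum /=; apply: eq_bigr => j _.
by rewrite !linearZ /= -(deriveE _ fd).
Qed.

Lemma iter_derive_rcons V W (vs : seq V) v (f : V -> W) :
  iter_derive (rcons vs v) f = iter_derive vs ('D_v f).
Proof. by elim: vs => //= u vs ->. Qed.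

Lemma smooth_on_derive V W (U : set V) (f : V -> W) v :
  smooth_on U f -> smooth_on U ('D_v f).
Proof. by move=> fU x Ux vs; rewrite -iter_derive_rcons; exact: fU. Qed.

(** By [differentiable_c1], one coordinate of the target at a time. *)
Lemma smooth_differentiable V W (cV : coordinates V) (cW : coordinates W)
    (U : set V) (f : V -> W) x :
  open U -> smooth_on U f -> U x -> differentiable f x.
Proof.
move=> oU fU Ux; apply: differentiable_coordP => i.
apply: (@differentiable_c1 _ _ _ _ U) => // y Uy v.
have fd z : U z -> derivable f z v by move=> Uz; have [_] := fU z Uz [::]; exact.
split.
  by have [] := is_derive_lin_comp (coord_fun_cont (i:=i)) (derivableP (fd _ Uy)).
have fc : {for y, continuous (coord_fun i \o 'D_v f)}.
  apply: continuous_comp; last exact: coord_fun_cont.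
  by have [] := fU y Uy [:: v].
apply: cvg_trans (_ : (coord_fun i \o 'D_v f) @ y --> 'D_v (coord_fun i \o f) y).
  apply: near_eq_cvg; apply: filterS (open_nbhs_nbhs (conj oU Uy)) => z Uz /=.
  by rewrite derive_coord_fun//; exact: fd.
by rewrite (derive_coord_fun _ (fd _ Uy)).
Qed.

Lemma smooth_onP V W (cV : coordinates V) (cW : coordinates W)
    (U : set V) (f : V -> W) : open U ->
  smooth_on U f <-> forall k, Ck k U f.
Proof.
move=> oU; split=> [fU k|].
  elim: k f fU => [|k IH] f fU.
    by split=> // x; exact: smooth_differentiable.
  split=> [x|v]; first exact: smooth_differentiable.
  by apply: IH; exact: smooth_on_derive.
move=> fC x Ux vs.
have : forall k, Ck k U (iter_derive vs f).
  by elim: vs => // v vs IH k; exact: (IH k.+1).2.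
move=> /(_ 0%N)/Ck_diff/(_ Ux) fd; split; first exact: differentiable_continuous.
by move=> v; exact: diff_derivable.
Qed.

Lemma smooth_on_Ck V W (cV : coordinates V) (cW : coordinates W) (U : set V)
  (f : V -> W) k : open U -> smooth_on U f -> Ck k U f.
Proof. by move=> oU /smooth_onP; exact. Qed.

Lemma smooth_on_eq V W (cV : coordinates V) (cW : coordinates W) (U : set V) (f g : V -> W) :
  open U -> (forall x, U x -> f x = g x) -> smooth_on U f -> smooth_on U g.
Proof.
by move=> oU fg /smooth_onP-/(_ oU) fC; apply/smooth_onP => // k; exact: Ck_eq (fC k).
Qed.

Lemma smooth_on_sub V W (U U' : set V) (f : V -> W) :
  U' `<=` U -> smooth_on U f -> smooth_on U' f.
Proof. by move=> UU fU x /UU; exact: fU. Qed.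

Lemma smooth_on_cst V W (cV : coordinates V) (cW : coordinates W) (U : set V) (c : W) :
  smooth_on U (fun _ : V => c).
Proof.
apply: (@smooth_on_sub _ _ setT) => //; apply/smooth_onP; first exact: openT.
by move=> k; exact: Ck_cst.
Qed.

Lemma smooth_on_lin V W (cV : coordinates V) (cW : coordinates W) (U : set V)
  (l : {linear V -> W}) : continuous l -> smooth_on U l.
Proof.
move=> lc; apply: (@smooth_on_sub _ _ setT) => //; apply/smooth_onP; first exact: openT.
by move=> k; exact: Ck_lin.
Qed.

Lemma smooth_onD V W (cV : coordinates V) (cW : coordinates W) (U : set V)
    (f g : V -> W) : open U ->
  smooth_on U f -> smooth_on U g -> smooth_on U (fun x => f x + g x).
Proof.
move=> oU /(smooth_onP _ _ _ oU) fC /(smooth_onP _ _ _ oU) gC.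
by apply/smooth_onP => // k; exact: Ck_add.
Qed.

Lemma smooth_on_sum V W (cV : coordinates V) (cW : coordinates W) (U : set V)
    (I : Type) (r : seq I) (F : I -> V -> W) : open U ->
  (forall i, smooth_on U (F i)) -> smooth_on U (fun x => \sum_(i <- r) F i x).
Proof.
move=> oU FC; apply/smooth_onP => // k; apply: Ck_sum => // i.
by move: k; apply/smooth_onP.
Qed.

Lemma smooth_onM V (cV : coordinates V) (U : set V) (f g : V -> R) : open U ->
  smooth_on U f -> smooth_on U g -> smooth_on U (fun x => f x * g x).
Proof.
move=> oU /(smooth_onP _ _ _ oU) fC /(smooth_onP _ _ _ oU) gC.
by apply/smooth_onP => // k; exact: Ck_mul.
Qed.

Lemma smooth_on_coordP V W (cV : coordinates V) (cW : coordinates W) (U : set V)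
    (f : V -> W) : open U ->
  smooth_on U f <-> forall i, smooth_on U (coord_fun i \o f).
Proof.
move=> oU; split=> [fU i|fU]; apply/smooth_onP => // k.
  by apply: (Ck_coordP k cW f oU).1; exact: smooth_on_Ck.
by apply/Ck_coordP => // i; exact: smooth_on_Ck.
Qed.

Lemma smooth_onZ V W (cV : coordinates V) (cW : coordinates W) (U : set V)
    (h : V -> R) (f : V -> W) : open U ->
  smooth_on U h -> smooth_on U f -> smooth_on U (fun x => h x *: f x).
Proof.
move=> oU hU fU; apply/(smooth_on_coordP _ _ _ oU) => i.
rewrite (_ : _ \o _ = fun x => h x * (coord_fun i \o f) x).
  by apply: smooth_onM => //; move: (i); apply/smooth_on_coordP.
by apply/funext => x /=; rewrite linearZ.
Qed.

Lemma smooth_on_comp V V' W (cV : coordinates V) (cV' : coordinates V')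
    (cW : coordinates W) (U : set V) (U' : set V') (f : V' -> W) (g : V -> V') :
  open U -> open U' -> (forall x, U x -> U' (g x)) ->
  smooth_on U' f -> smooth_on U g -> smooth_on U (f \o g).
Proof.
move=> oU oU' UU' /(smooth_onP _ _ _ oU') fC /(smooth_onP _ _ _ oU) gC.
by apply/smooth_onP => // k; exact: Ck_comp (fC k) (gC k).
Qed.

Lemma smooth_on_lin_comp V W W' (cV : coordinates V) (cW : coordinates W)
    (cW' : coordinates W') (U : set V) (l : {linear W -> W'}) (f : V -> W) :
  open U -> continuous l -> smooth_on U f -> smooth_on U (l \o f).
Proof.
move=> oU lc fU; apply: (@smooth_on_comp _ _ _ _ _ _ _ setT) => //.
  exact: openT.
exact: smooth_on_lin.
Qed.

Lemma smooth_on_pair V W W' (cV : coordinates V) (cW : coordinates W)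
    (cW' : coordinates W') (U : set V) (f : V -> W) (g : V -> W') : open U ->
  smooth_on U f -> smooth_on U g -> smooth_on U (fun x => (f x, g x)).
Proof.
move=> oU fU gU; apply/(smooth_on_coordP _ _ _ oU) => i.
rewrite -(splitK i); case: (fintype.split i) => j /=.
  rewrite (_ : _ \o _ = coord_fun j \o f).
    by move: j; apply/smooth_on_coordP.
  by apply/funext => x /=; rewrite (unsplitK (inl j)).
rewrite (_ : _ \o _ = coord_fun j \o g).
  by move: j; apply/smooth_on_coordP.
by apply/funext => x /=; rewrite (unsplitK (inr j)).
Qed.

(** The mean value theorem, applied to [y |-> f (y + w) - f y] in direction [v]
and then to [D_v f] in direction [w]. *)
Lemma mixed_difference V (cV : coordinates V) (U : set V) (f : V -> R) x v w :
  open U -> smooth_on U f ->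
  (forall a b, 0 <= a <= 1 -> 0 <= b <= 1 -> U (x + a *: v + b *: w)) ->
  exists a b, [/\ 0 <= a <= 1, 0 <= b <= 1 &
    f (x + v + w) - f (x + v) - (f (x + w) - f x) =
    'D_w ('D_v f) (x + a *: v + b *: w)].
Proof.
move=> oU fU xU.
pose phi y := f (y + w) - f y.
have fd y u : U y -> derivable f y u.
  by move=> Uy; apply: diff_derivable; exact: smooth_differentiable Uy.
have phid a : 0 <= a <= 1 -> is_derive (x + a *: v) v phi
    ('D_v f (x + a *: v + w) - 'D_v f (x + a *: v)).
  move=> a01; apply: is_deriveB.
    have /derivableP/is_deriveP fD : derivable f (x + a *: v + w) v.
      by apply: fd; have := xU a 1 a01; rewrite scale1r ler01 lexx; exact.
    apply/is_deriveP => e /fD; apply: filterS => h.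
    by rewrite addrA.
  apply/derivableP/fd; have := xU a 0 a01; rewrite scale0r addr0 lexx ler01; exact.
have [a a01|a /andP[a0 a1] phiE] := @mean_value_dir R V phi x v.
  by have [] := phid _ a01.
have a01 : 0 <= a <= 1 by rewrite !ltW.
have [b b01|b /andP[b0 b1] fE] := @mean_value_dir R V ('D_v f) (x + a *: v) w.
  apply: diff_derivable; apply: (@smooth_differentiable _ _ _ _ U) => //.
    exact: smooth_on_derive.
  exact: xU.
exists a, b; split=> //; first by rewrite !ltW.
by rewrite -fE -/(phi _) phiE; have [_ ->] := phid _ a01.
Qed.

(** Schwarz: for small [t], the mixed second difference of [f] with steps [t v]
and [t w] is [t^2] times a value close to [D_w D_v f x] and, in the other order,
[t^2] times a value close to [D_v D_w f x]. *)
Lemma derive_commute V (cV : coordinates V) (U : set V) (f : V -> R) x v w :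
  open U -> smooth_on U f -> U x -> 'D_v ('D_w f) x = 'D_w ('D_v f) x.
Proof.
move=> oU fU Ux; apply/eqP; rewrite -subr_eq0 -normr_le0 leNgt; apply/negP => e0.
set e := `|_| in e0.
have e20 : 0 < e / 3 by rewrite divr_gt0.
have DDc u u' : {for x, continuous ('D_u ('D_u' f))}.
  by have [] := fU x Ux [:: u; u'].
have nearDD u u' : \forall y \near x, `|'D_u ('D_u' f) x - 'D_u ('D_u' f) y| < e / 3.
  by have /cvgrPdist_lt := DDc u u'; exact.
have near3 : \forall y \near x, [/\ U y,
    `|'D_v ('D_w f) x - 'D_v ('D_w f) y| < e / 3 &
    `|'D_w ('D_v f) x - 'D_w ('D_v f) y| < e / 3].
  apply: filterS3 (open_nbhs_nbhs (conj oU Ux)) (nearDD v w) (nearDD w v).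
  by move=> y; split.
have /nbhs_normP[d /= d0 xd] := near3.
have N0 : 0 < `|v| + `|w| + 1 by rewrite ltr_wpDl ?addr_ge0.
have [t t0 td] : exists2 t, 0 < t & t * (`|v| + `|w|) < d.
  exists (d / (`|v| + `|w| + 1)); first by rewrite divr_gt0.
  by rewrite mulrAC ltr_pdivrMr// ltr_pM2l// ltrDl.
have inball a b : 0 <= a <= 1 -> 0 <= b <= 1 ->
    ball_ Num.norm x d (x + a *: (t *: v) + b *: (t *: w)).
  move=> /andP[a0 a1] /andP[b0 b1]; rewrite /ball_ /= -addrA opprD addNKr normrN.
  rewrite (le_lt_trans (ler_normD _ _))// !normrZ.
  rewrite !(ger0_norm (ltW t0)) (ger0_norm a0) (ger0_norm b0).
  apply: (@le_lt_trans _ _ (t * `|v| + t * `|w|)).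
    by apply: lerD; rewrite ler_piMl ?mulr_ge0// ltW.
  by rewrite -mulrDr.
have DD u u' y : U y -> 'D_(t *: u) ('D_(t *: u') f) y = t * t * 'D_u ('D_u' f) y.
  move=> Uy; rewrite (near_eq_derive (g := t \*: 'D_u' f)); last first.
    apply: filterS (open_nbhs_nbhs (conj oU Uy)) => z Uz.
    have /derivableP/(is_derive_dir t)[_ ->//] : derivable f z u'.
    by have [_] := fU z Uz [::]; exact.
  have fD : derivable ('D_u' f) y u by have [_] := fU y Uy [:: u']; exact.
  have [_ ->] := is_derive_dir t (derivableP (derivableZ (k := t) fD)).
  by rewrite deriveZ// scalerA.
have [a [b [a01 b01 E1]]] := @mixed_difference V _ U f x (t *: v) (t *: w) oU fU
  (fun a b a01 b01 => let: And3 h _ _ := xd _ (inball a b a01 b01) in h).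
have inball' a' b' : 0 <= a' <= 1 -> 0 <= b' <= 1 ->
    ball_ Num.norm x d (x + a' *: (t *: w) + b' *: (t *: v)).
  by move=> a'01 b'01; rewrite addrAC; exact: inball.
have [a' [b' [a'01 b'01 E2]]] := @mixed_difference V _ U f x (t *: w) (t *: v) oU fU
  (fun a b a01 b01 => let: And3 h _ _ := xd _ (inball' a b a01 b01) in h).
have [Uy _ yB] := xd _ (inball a b a01 b01).
have [Uy' yA _] := xd _ (inball' a' b' a'01 b'01).
rewrite DD// in E1; rewrite DD// in E2.
rewrite [x + _ + _]addrAC in E2.
move: E1 E2 yA yB; move: ('D_w ('D_v f) (x + _ + _)) ('D_v ('D_w f) (x + _ + _)).
move=> B A E1 E2 yA yB.
(* The two orders produce the same second difference. *)
have AB : A = B.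
  apply: (@mulfI _ (t * t)); first by rewrite mulf_neq0// gt_eqF.
  by rewrite -E1 -E2 !opprB addrACA [RHS]addrACA [- _ - _ in RHS]addrC.
have : e < e / 3 + e / 3.
  rewrite {1}/e (_ : _ - _ = ('D_v ('D_w f) x - A) - ('D_w ('D_v f) x - B)).
    by rewrite (le_lt_trans (ler_normB _ _))// ltrD.
  by rewrite AB opprB addrA subrK.
by move: e0; lra.
Qed.

Lemma smooth_at_near V W (cV : coordinates V) (cW : coordinates W)
    (f g : V -> W) (x : V) :
  (\forall y \near x, f y = g y) -> smooth_at x f -> smooth_at x g.
Proof.
rewrite -nbhs_nearE nbhsE => -[U' [oU' U'x] fg] [U [oU Ux fU]].
have oI := openI oU oU'; exists (U `&` U'); split=> //.
apply: (smooth_on_eq _ _ oI (f := f)); first by move=> y [_ /fg].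
by apply: smooth_on_sub fU => y [].
Qed.

Lemma smooth_at_diff V W (cV : coordinates V) (cW : coordinates W)
  (f : V -> W) (x : V) : smooth_at x f -> differentiable f x.
Proof. by move=> [U [oU Ux fU]]; exact: smooth_differentiable fU Ux. Qed.

Lemma smooth_at_binary V W1 W2 W (f : V -> W1) (g : V -> W2) (x : V)
   (h : V -> W) :
  (forall U : set V, open U -> smooth_on U f -> smooth_on U g -> smooth_on U h) ->
  smooth_at x f -> smooth_at x g -> smooth_at x h.
Proof.
move=> fgh [U [oU Ux fU]] [U' [oU' U'x gU']]; exists (U `&` U'); split=> //.
  exact: openI.
apply: fgh; first exact: openI.
  by apply: smooth_on_sub fU => ? [].
by apply: smooth_on_sub gU' => ? [].
Qed.

End SmoothClass.

(** * Bump functions *)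

Section Bump.
Context {R : realType}.

(** The functions [t^-k exp (-1/t)], extended by zero, form a family whose
derivatives are combinations of its members, so that their smoothness at the
origin follows from differentiability of each of them. *)
Definition flat_exp k (t : R) : R := if 0 < t then t^-1 ^+ k * expR (- t^-1) else 0.

(** From [exp s >= s^(k+2) / (k+2)!] with [s = 1/t]. *)
Lemma flat_exp_bound k t : `|flat_exp k t| <= (k.+2)`!%:R * `|t| ^+ 2.
Proof.
rewrite /flat_exp; case: ifPn => [t0|_]; last by rewrite normr0 mulr_ge0.
have s0 : 0 < t^-1 by rewrite invr_gt0.
rewrite ger0_norm ?mulr_ge0 ?expR_ge0 ?exprn_ge0 ?(ltW s0)// (ger0_norm (ltW t0)).
rewrite expRN ler_pdivrMr ?expR_gt0//.
apply: (@le_trans _ _ ((k.+2)`!%:R * t ^+ 2 * (t^-1 ^+ k.+2 / (k.+2)`!%:R))).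
  have f0 : ((k.+2)`!%:R : R) != 0 by rewrite pnatr_eq0 -lt0n fact_gt0.
  rewrite -[t^-1 ^+ k.+2]/(t^-1 ^+ (2 + k)) exprD; move: (_%:R : R) f0 => c f0.
  have -> : c * t ^+ 2 * (t^-1 ^+ 2 * t^-1 ^+ k / c) = c / c * (t * t^-1) ^+ 2 * t^-1 ^+ k.
    by ring.
  by rewrite (mulfV f0) mulfV ?gt_eqF// expr1n !mul1r.
rewrite ler_wpM2l ?mulr_ge0 ?exprn_ge0 ?(ltW t0)//.
by apply: le_trans (expR_ge1Dxn k.+1 (ltW s0)); rewrite lerDr.
Qed.

Lemma is_derive_flat_exp k (t : R) :
  is_derive t 1 (flat_exp k) (flat_exp k.+2 t - k%:R * flat_exp k.+1 t).
Proof.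
have [t0|t0|<-] := ltgtP 0 t.
- have : is_derive t 1 (fun t : R => t^-1 ^+ k * expR (- t^-1))
    (flat_exp k.+2 t - k%:R * flat_exp k.+1 t).
    have dV : is_derive t 1 (fun t : R => t^-1) (- (t^-1 * t^-1)).
      have t1 : t != 0 by rewrite gt_eqF.
      have h := @is_deriveV R id t 1 1 t1 (is_derive_id t 1).
      apply: (is_derive_eq h).
      by rewrite /= expr2 invfM [_%:A]mulr1.
    have dE : is_derive t 1 (expR \o (fun t : R => - t^-1)) (expR (- t^-1) * (t^-1 * t^-1)).
      by rewrite -[t^-1 * t^-1 in X in is_derive _ _ _ X]opprK; exact: is_derive1_comp.
    have h := is_deriveM (is_deriveX k dV) dE; rewrite exprfctE in h; apply: (is_derive_eq h).
    rewrite -[t^-1 ^+ k *: _]/(_ * _) -[(_ \o _) t *: _]/(_ * (_ * _)) /flat_exp t0 /=.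
    by case: k {h} => [|k] /=; rewrite ?exprS; ring.
  apply: near_eq_is_derive; apply: filterS (lt_nbhsr t0) => s s0.
  by rewrite /flat_exp s0.
- rewrite /flat_exp !(ltNge 0 t) (ltW t0) /= mulr0 subrr.
  apply: near_eq_is_derive (is_derive_cst 0 t 1).
  by apply: filterS (lt_nbhsl t0) => s s0; rewrite ltNge (ltW s0).
- rewrite /flat_exp ltxx mulr0 subrr; apply/is_deriveP => e e0.
  pose c : R := (k.+2)`!%:R.
  have c0 : 0 < c by rewrite ltr0n fact_gt0.
  have : \forall h \near (0 : R), `|h| < e / c by apply: nbhs0_lt; rewrite divr_gt0.
  apply: filterS => h; rewrite ltr_pdivlMr// => he.
  rewrite ltxx subr0 scaler0 subr0 addr0 [_%:A]mulr1.
  apply: le_trans (flat_exp_bound k h) _.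
  by rewrite -/c expr2 mulrA ler_wpM2r// mulrC ltW.
Qed.

Lemma smooth_on_flat_exp k : smooth_on setT (flat_exp k).
Proof.
apply/smooth_onP; first exact: openT.
move=> m; elim: m k => [|m IH] k.
  split=> // t _; apply/derivable1_diffP.
  by have [] := is_derive_flat_exp k t.
split=> [t _|v]; first by apply/derivable1_diffP; have [] := is_derive_flat_exp k t.
rewrite (_ : derive _ ^~ v = fun t => v * (flat_exp k.+2 t + - k%:R * flat_exp k.+1 t)).
  have oT := @openT R.
  apply: (Ck_mul oT (Ck_cst _ _ v)); apply: (Ck_add oT (IH k.+2)).
  exact: (Ck_mul oT (Ck_cst _ _ _) (IH k.+1)).
apply/funext => t; have := is_derive_dir v (is_derive_flat_exp k t).
by rewrite [v%:A]mulr1 => -[_ ->]; rewrite mulNr.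
Qed.

(** The support of [flat_exp 0 (s^2 - |x - x0|^2)] is contained in a compact
cube of half side [s], that is, a closed ball of the sup norm. *)
Lemma bump_function n (U : set 'rV[R]_n) x0 : open U -> U x0 ->
  exists (b : 'rV[R]_n -> R) K, [/\ smooth_on setT b, b x0 = 1, compact K, K `<=` U &
    forall x, ~ K x -> b x = 0].
Proof.
move=> oU Ux0.
have /nbhs_normP[r /= r0 rU] := open_nbhs_nbhs (conj oU Ux0).
pose s := r / 2; have s0 : 0 < s by rewrite divr_gt0.
pose q (x : 'rV[R]_n) := s ^+ 2 - \sum_(i < n) (x 0 i - x0 0 i) ^+ 2.
have qx0 : q x0 = s ^+ 2.
  by rewrite /q big1 ?subr0// => i _; rewrite subrr expr0n.
have qs : smooth_on setT q.
  have oT := @openT 'rV[R]_n.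
  rewrite (_ : q = fun x => s ^+ 2 + -1 * \sum_(i < n)
    (x 0 i + - x0 0 i) * (x 0 i + - x0 0 i)); last first.
    by apply/funext => x; rewrite /q mulN1r; under eq_bigr do rewrite expr2.
  apply: smooth_onD => //; first exact: smooth_on_cst.
  apply: smooth_onM => //; first exact: smooth_on_cst.
  apply: smooth_on_sum => // i.
  have ls : smooth_on setT (fun x : 'rV[R]_n => x 0 i + - x0 0 i).
    apply: smooth_onD => //; last exact: smooth_on_cst.
    by apply: (@smooth_on_lin _ _ _ _ _ _ (coord_rV i)) => x; exact: coord_continuous.
  exact: smooth_onM.
pose K := [set x : 'rV[R]_n | forall i, `[x0 0 i - s, x0 0 i + s]%classic (x 0 i)].
have KP x : K x <-> forall i, `|x 0 i - x0 0 i| <= s.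
  by split=> h i; have := h i; rewrite /= in_itv /= ler_distl.
exists (fun x => (flat_exp 0 (s ^+ 2))^-1 * flat_exp 0 (q x)), K.
have p0 : 0 < flat_exp 0 (s ^+ 2).
  by rewrite /flat_exp exprn_gt0// mulr_gt0 ?expR_gt0.
split.
- have oT := @openT 'rV[R]_n.
  have fq : smooth_on setT (flat_exp 0 \o q).
    exact: (smooth_on_comp _ _ _ oT (@openT R) (fun _ _ => I) (smooth_on_flat_exp 0) qs).
  exact: (smooth_onM _ oT (smooth_on_cst _ _ (flat_exp 0 (s ^+ 2))^-1) fq).
- by rewrite qx0 mulVf// gt_eqF.
- apply: (@rV_compact R n (fun i => `[x0 0 i - s, x0 0 i + s]%classic)) => i.
  exact: segment_compact.
- move=> x /KP xs; apply: rU; rewrite /ball_ /= distrC.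
  apply: (@le_lt_trans _ _ s); last by rewrite /s ltr_pdivrMr// ltr_pMr// ltr1n.
  rewrite /Num.Def.normr /= mx_normrE bigmax_le ?(ltW s0)// => -[i j] _ /=.
  by rewrite ord1 !mxE.
- move=> x xK; rewrite [flat_exp 0 (q x)]/flat_exp; case: ifPn; last by rewrite mulr0.
  move=> qx; exfalso; apply: xK; apply/KP => i; rewrite -ler_sqr ?nnegrE ?(ltW s0)//.
  rewrite real_normK ?num_real// -subr_ge0 (le_trans (ltW qx))// lerD2l lerN2.
  rewrite (bigD1 i)//= lerDl sumr_ge0// => j _; exact: sqr_ge0.
Qed.

End Bump.

(** * Coordinate changes of the manifold and of its tangent bundle *)

Section Charts.
Context {R : realType} {n : nat} {M : topologicalType}.
Variable (A : smooth_atlas R n M).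

Local Notation E := ('rV[R]_n).
Local Notation TM := (M * 'rV[R]_n)%type.
Local Notation chart := (chart R n M).
Implicit Types (c : chart) (p : M) (u q : TM) (x y v a b : E) (z w : E * E).

Definition overlap c c' : set E := cmap c @` (cdom c `&` cdom c').

Definition trans c c' : E -> E := cmap c' \o cinv c.

Lemma chartK c p : cdom c p -> cinv c (cmap c p) = p.
Proof. by move=> cp; apply: cmapK; rewrite inE. Qed.

Lemma overlapP c c' x : overlap c c' x <->
  [/\ (cmap c @` cdom c) x, cdom c' (cinv c x) & cmap c (cinv c x) = x].
Proof.
split; first by move=> [p [cp c'p] <-]; rewrite chartK//; split=> //; exists p.
by move=> [[p cp <-]]; rewrite chartK// => c'p _; exists p.
Qed.

Lemma overlap_dom c c' x : overlap c c' x -> cdom c (cinv c x) /\ cdom c' (cinv c x).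
Proof. by move=> [p [cp c'p] <-]; rewrite chartK. Qed.

Lemma overlap_map c c' p : cdom c p -> cdom c' p -> overlap c c' (cmap c p).
Proof. by move=> cp c'p; exists p. Qed.

Lemma cinvK c c' x : overlap c c' x -> cmap c (cinv c x) = x.
Proof. by move=> /overlapP[]. Qed.

Lemma overlap_open c c' : open (overlap c c').
Proof.
rewrite (_ : overlap c c' = (cmap c @` cdom c) `&` cinv c @^-1` cdom c').
  apply: open_preimage_on; first exact: cimg_open.
    exact: cdom_open.
  by move=> x; exact: cinv_cts.
apply/seteqP; split=> x; first by move=> /overlapP[].
by move=> [cx c'x]; apply/overlapP; split=> //; case: cx => p cp <-; rewrite chartK.
Qed.

Lemma near_overlap c c' x : overlap c c' x -> \forall x' \near x, overlap c c' x'.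
Proof. by move=> xo; apply: open_nbhs_nbhs; split=> //; exact: overlap_open. Qed.

Lemma trans_smooth c c' : in_atlas A c -> in_atlas A c' ->
  smooth_on (overlap c c') (trans c c').
Proof. exact: transition_smooth. Qed.

Lemma trans_diff c c' x : in_atlas A c -> in_atlas A c' -> overlap c c' x ->
  differentiable (trans c c') x.
Proof.
move=> Ac Ac'; apply: smooth_differentiable; first exact: overlap_open.
exact: trans_smooth.
Qed.

Lemma trans_id c x y : overlap c c x -> 'D_y (trans c c) x = y.
Proof.
move=> xo; rewrite -[RHS](derive_id x y); apply: near_eq_derive.
by apply: filterS (near_overlap xo) => x'; exact: cinvK.
Qed.

(** The chain rule for coordinate changes. *)
Lemma trans_cocycle c1 c2 c3 p y :
  in_atlas A c1 -> in_atlas A c2 -> in_atlas A c3 ->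
  cdom c1 p -> cdom c2 p -> cdom c3 p ->
  'D_('D_y (trans c1 c2) (cmap c1 p)) (trans c2 c3) (cmap c2 p) =
  'D_y (trans c1 c3) (cmap c1 p).
Proof.
move=> A1 A2 A3 p1 p2 p3.
have E2 : cmap c2 p = trans c1 c2 (cmap c1 p) by rewrite /trans /= chartK.
rewrite {1}E2 -chain_rule.
- apply: near_eq_derive; apply: filterS (near_overlap (overlap_map p1 p2)) => x xo.
  by rewrite /trans /= chartK//; exact: (overlap_dom xo).2.
- by apply: trans_diff => //; exact: overlap_map.
- by rewrite -E2; apply: trans_diff => //; exact: overlap_map.
Qed.

Local Notation chart_at := (chart_at A).
Local Notation vec_of := (vec_of A).
Local Notation vec_coord := (vec_coord A).
Local Notation tm_of := (tm_of A).
Local Notation tm_coord := (tm_coord A).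

Lemma vec_ofE c p y : vec_of c p y = 'D_y (trans c (chart_at p)) (cmap c p).
Proof. by []. Qed.

Lemma vec_coordE c p v :
  vec_coord c p v = 'D_v (trans (chart_at p) c) (cmap (chart_at p) p).
Proof. by []. Qed.

Lemma vec_coord_of c c' p y :
  in_atlas A c -> in_atlas A c' -> cdom c p -> cdom c' p ->
  vec_coord c' p (vec_of c p y) = 'D_y (trans c c') (cmap c p).
Proof.
move=> Ac Ac' cp c'p; apply: trans_cocycle => //.
  exact: chart_at_atlas.
exact: chart_at_dom.
Qed.

Lemma vec_ofK c p y : in_atlas A c -> cdom c p -> vec_coord c p (vec_of c p y) = y.
Proof. by move=> Ac cp; rewrite vec_coord_of// trans_id//; exact: overlap_map. Qed.

Lemma vec_coordK c p v : in_atlas A c -> cdom c p -> vec_of c p (vec_coord c p v) = v.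
Proof.
move=> Ac cp; have pp := chart_at_dom A p; have Ap := chart_at_atlas A p.
by rewrite vec_ofE vec_coordE trans_cocycle// trans_id//; exact: overlap_map.
Qed.

Lemma vec_of_lin c p : in_atlas A c -> cdom c p -> linear (vec_of c p).
Proof.
move=> Ac cp a x y.
have fd : differentiable (trans c (chart_at p)) (cmap c p).
  apply: trans_diff => //; first exact: chart_at_atlas.
  by apply: overlap_map => //; exact: chart_at_dom.
by rewrite !vec_ofE !(deriveE _ fd) linearP.
Qed.

Lemma vec_coord_lin c p : in_atlas A c -> cdom c p -> linear (vec_coord c p).
Proof.
move=> Ac cp a x y.
have fd : differentiable (trans (chart_at p) c) (cmap (chart_at p) p).
  apply: trans_diff => //; first exact: chart_at_atlas.
  by apply: overlap_map => //; exact: chart_at_dom.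
by rewrite !vec_coordE !(deriveE _ fd) linearP.
Qed.

Lemma vec_of_at p y : vec_of (chart_at p) p y = y.
Proof. by rewrite vec_ofE trans_id//; apply: overlap_map; exact: chart_at_dom. Qed.

Lemma vec_coord_at p y : vec_coord (chart_at p) p y = y.
Proof. by rewrite vec_coordE trans_id//; apply: overlap_map; exact: chart_at_dom. Qed.

Lemma vec_of_neq0 c p y : in_atlas A c -> cdom c p -> y != 0 -> vec_of c p y != 0.
Proof.
move=> Ac cp; apply: contra_neq => yE; rewrite -(vec_ofK y Ac cp) yE.
exact: derive0.
Qed.

Definition tm_overlap c c' : set (E * E) := [set z | overlap c c' z.1].

Definition tm_trans c c' z : E * E := (trans c c' z.1, 'D_z.2 (trans c c') z.1).

Lemma tm_overlap_open c c' : open (tm_overlap c c').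
Proof.
rewrite (_ : tm_overlap c c' = setT `&` fst @^-1` overlap c c'); last first.
  by rewrite setTI.
apply: open_preimage_on; [exact: openT|exact: overlap_open|].
by move=> z _; exact: cvg_fst.
Qed.

Lemma near_tm_overlap c c' z : tm_overlap c c' z -> \forall z' \near z, tm_overlap c c' z'.
Proof. by move=> zo; apply: open_nbhs_nbhs; split=> //; exact: tm_overlap_open. Qed.

Lemma tm_trans_smooth c c' : in_atlas A c -> in_atlas A c' ->
  smooth_on (tm_overlap c c') (tm_trans c c').
Proof.
move=> Ac Ac'; have oU := @tm_overlap_open c c'.
have fs1 : smooth_on (tm_overlap c c') (fun z : E * E => z.1).
  by apply: (@smooth_on_lin _ _ _ _ _ _ (pair1 _ _)) => z; exact: cvg_fst.
have fs2 : smooth_on (tm_overlap c c') (fun z : E * E => z.2).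
  by apply: (@smooth_on_lin _ _ _ _ _ _ (pair2 _ _)) => z; exact: cvg_snd.
have ts := trans_smooth Ac Ac'.
have oo := @overlap_open c c'.
have f1 : smooth_on (tm_overlap c c') (trans c c' \o fst).
  exact: (smooth_on_comp _ _ _ oU oo (fun _ h => h) ts fs1).
have f2 : smooth_on (tm_overlap c c') (fun z => 'D_z.2 (trans c c') z.1).
  have fi (i : 'I_n) : smooth_on (tm_overlap c c')
      (fun z => z.2 0 i *: 'D_(delta_mx 0 i) (trans c c') z.1).
    have g1 : smooth_on (tm_overlap c c') (coord_rV i \o snd).
      exact: (smooth_on_lin_comp _ _ _ oU (coord_rV_cont (i := i)) fs2).
    have g2 : smooth_on (tm_overlap c c') ('D_(delta_mx 0 i) (trans c c') \o fst).
      exact: (smooth_on_comp _ _ _ oU oo (fun _ h => h)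
        (smooth_on_derive (delta_mx 0 i) ts) fs1).
    exact: (smooth_onZ _ _ oU g1 g2).
  apply: (smooth_on_eq _ _ oU _ (smooth_on_sum _ _ (index_enum 'I_n) oU fi)) => z zo.
  have td := trans_diff Ac Ac' zo.
  rewrite (deriveE _ td) [in RHS](row_sum_delta z.2) linear_sum.
  by apply: eq_bigr => i _; rewrite linearZ -(deriveE _ td).
exact: (smooth_on_pair _ _ _ oU f1 f2).
Qed.

Lemma tm_trans_diff c c' z : in_atlas A c -> in_atlas A c' -> tm_overlap c c' z ->
  differentiable (tm_trans c c') z.
Proof.
move=> Ac Ac'; apply: smooth_differentiable; first exact: tm_overlap_open.
exact: tm_trans_smooth.
Qed.

Lemma tm_coord_of c c' z : in_atlas A c -> in_atlas A c' -> tm_overlap c c' z ->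
  tm_coord c' (tm_of c z) = tm_trans c c' z.
Proof.
move=> Ac Ac' zo; have [cp c'p] := overlap_dom zo.
by rewrite /Defs.tm_coord /Defs.tm_of /= vec_coord_of// (cinvK zo).
Qed.

Lemma tm_coordK c u : in_atlas A c -> cdom c u.1 -> tm_of c (tm_coord c u) = u.
Proof.
move=> Ac cu; rewrite /Defs.tm_of /Defs.tm_coord /= chartK// vec_coordK//.
by case: u {cu}.
Qed.

Lemma tm_overlap_coord c c' u : cdom c u.1 -> cdom c' u.1 ->
  tm_overlap c c' (tm_coord c u).
Proof. exact: overlap_map. Qed.

Lemma tm_trans_coord c c' u : in_atlas A c -> in_atlas A c' ->
  cdom c u.1 -> cdom c' u.1 -> tm_trans c c' (tm_coord c u) = tm_coord c' u.
Proof.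
by move=> Ac Ac' cu c'u; rewrite -tm_coord_of ?tm_coordK//; exact: tm_overlap_coord.
Qed.

Lemma tm_coord_at p y : tm_coord (chart_at p) (p, y) = (cmap (chart_at p) p, y).
Proof. by rewrite /Defs.tm_coord /= vec_coord_at. Qed.

Lemma tm_of_at p y : tm_of (chart_at p) (cmap (chart_at p) p, y) = (p, y).
Proof. by rewrite /Defs.tm_of /= chartK ?vec_of_at//; exact: chart_at_dom. Qed.

(** The inverse of [tvec_coord c u]: components in the preferred chart of the
vector with components [w] in [c]. *)
Definition tvec_of c u w : E * E :=
  'D_w (tm_coord (chart_at u.1) \o tm_of c) (tm_coord c u).

Lemma tm_coord_of_derive c c' u w : in_atlas A c -> in_atlas A c' ->
  cdom c u.1 -> cdom c' u.1 ->
  'D_w (tm_coord c' \o tm_of c) (tm_coord c u) = 'D_w (tm_trans c c') (tm_coord c u).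
Proof.
move=> Ac Ac' cu c'u; apply: near_eq_derive.
by apply: filterS (near_tm_overlap (tm_overlap_coord cu c'u)) => z; exact: tm_coord_of.
Qed.

Lemma tvec_coordE c u w : in_atlas A c -> cdom c u.1 ->
  tvec_coord A c u w =
  'D_w (tm_trans (chart_at u.1) c) (tm_coord (chart_at u.1) u).
Proof.
move=> Ac cu; apply: tm_coord_of_derive => //; first exact: chart_at_atlas.
exact: chart_at_dom.
Qed.

Lemma tvec_ofE c u w : in_atlas A c -> cdom c u.1 ->
  tvec_of c u w = 'D_w (tm_trans c (chart_at u.1)) (tm_coord c u).
Proof.
move=> Ac cu; apply: tm_coord_of_derive => //; first exact: chart_at_atlas.
exact: chart_at_dom.
Qed.

Lemma tvec_coord_of c c' u w : in_atlas A c -> in_atlas A c' ->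
  cdom c u.1 -> cdom c' u.1 ->
  tvec_coord A c' u (tvec_of c u w) = 'D_w (tm_trans c c') (tm_coord c u).
Proof.
move=> Ac Ac' cu c'u; rewrite (tvec_coordE _ Ac' c'u) (tvec_ofE _ Ac cu).
have uu := chart_at_dom A u.1; have Au := chart_at_atlas A u.1.
rewrite -[X in 'D__ _ X](tm_trans_coord Ac Au cu uu) -chain_rule.
- apply: near_eq_derive.
  apply: filterS2 (near_tm_overlap (tm_overlap_coord cu c'u))
    (near_tm_overlap (tm_overlap_coord cu uu)) => z zo' zo /=.
  rewrite -(tm_coord_of Ac Ac' zo') -(tm_coord_of Ac Au zo).
  have [cz uz] := overlap_dom zo; have [_ c'z] := overlap_dom zo'.
  rewrite tm_trans_coord//.
- by apply: tm_trans_diff => //; exact: tm_overlap_coord.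
- by rewrite tm_trans_coord//; apply: tm_trans_diff => //; exact: tm_overlap_coord.
Qed.

Lemma tvec_coordZ c u (k : R) w : in_atlas A c -> cdom c u.1 ->
  tvec_coord A c u (k *: w) = k *: tvec_coord A c u w.
Proof.
move=> Ac cu.
have fd : differentiable (tm_trans (chart_at u.1) c) (tm_coord (chart_at u.1) u).
  apply: tm_trans_diff => //; first exact: chart_at_atlas.
  by apply: tm_overlap_coord => //; exact: chart_at_dom.
by rewrite !(tvec_coordE _ Ac cu) !(deriveE _ fd) linearZ.
Qed.

Lemma tm_trans_derive1 c c' z w : in_atlas A c -> in_atlas A c' -> tm_overlap c c' z ->
  ('D_w (tm_trans c c') z).1 = 'D_w.1 (trans c c') z.1.
Proof.
move=> Ac Ac' zo; rewrite derive_pair1//.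
by apply: diff_derivable; exact: tm_trans_diff.
Qed.

Lemma rho_tvec_of c u w : in_atlas A c -> cdom c u.1 ->
  rho (tvec_of c u w) = vec_of c u.1 w.1.
Proof.
move=> Ac cu; rewrite (tvec_ofE _ Ac cu) /rho tm_trans_derive1 ?vec_ofE//.
  exact: chart_at_atlas.
by apply: tm_overlap_coord => //; exact: chart_at_dom.
Qed.

Lemma tvec_coord1 c u w : in_atlas A c -> cdom c u.1 ->
  (tvec_coord A c u w).1 = vec_coord c u.1 w.1.
Proof.
move=> Ac cu; rewrite (tvec_coordE _ Ac cu) tm_trans_derive1//.
  exact: chart_at_atlas.
by apply: tm_overlap_coord => //; exact: chart_at_dom.
Qed.

Lemma tm_trans_id c z w : in_atlas A c -> tm_overlap c c z -> 'D_w (tm_trans c c) z = w.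
Proof.
move=> Ac zo; rewrite -[RHS](derive_id z w); apply: near_eq_derive.
apply: filterS (near_tm_overlap zo) => z' z'o.
rewrite /tm_trans trans_id// /trans /= (cinvK z'o).
by case: z' {z'o}.
Qed.

Lemma tvec_coord_at u w : tvec_coord A (chart_at u.1) u w = w.
Proof.
rewrite tvec_coordE; [|exact: chart_at_atlas|exact: chart_at_dom].
by rewrite tm_trans_id//; [exact: chart_at_atlas|apply: tm_overlap_coord; exact: chart_at_dom].
Qed.

Lemma tvec_of_at u w : tvec_of (chart_at u.1) u w = w.
Proof. exact: tvec_coord_at. Qed.

End Charts.

(** * Smooth sections over the slit tangent bundle *)

Section SmoothSections.
Context {R : realType} {n : nat} {M : topologicalType}.
Variable (A : smooth_atlas R n M).

Local Notation E := ('rV[R]_n).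
Local Notation TM := (M * 'rV[R]_n)%type.
Local Notation chart := (chart R n M).
Local Notation chart_at := (chart_at A).
Local Notation vec_of := (vec_of A).
Local Notation vec_coord := (vec_coord A).
Local Notation tm_of := (tm_of A).
Local Notation tm_coord := (tm_coord A).
Local Notation slit := (@slit R n M).
Implicit Types (c : chart) (p : M) (u q : TM) (x y v a b : E) (z w : E * E).

(** Neighbourhoods of [u] in the tangent bundle. They are read in the induced
charts: the preferred chart may vary without any continuity in the point, so the
product topology of the carrier is not that of the tangent bundle. *)
Definition near_tm u (N : TM -> Prop) := forall c, in_atlas A c -> cdom c u.1 ->
  \forall z \near tm_coord c u, N (tm_of c z).

Lemma near_tmW u (N N' : TM -> Prop) : (forall q, N q -> N' q) -> near_tm u N -> near_tm u N'.
Proof. by move=> NN uN c Ac cu; apply: filterS (uN c Ac cu) => z; exact: NN. Qed.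

Lemma near_tm_self u (N : TM -> Prop) : near_tm u N -> N u.
Proof.
move=> /(_ _ (chart_at_atlas A u.1) (chart_at_dom A u.1))/nbhs_singleton.
by rewrite tm_coordK//; [exact: chart_at_atlas | exact: chart_at_dom].
Qed.

Lemma near_tm_dom c u : in_atlas A c -> cdom c u.1 -> near_tm u (fun q => cdom c q.1).
Proof.
move=> Ac cu c' Ac' c'u; apply: filterS (near_tm_overlap (tm_overlap_coord A c'u cu)) => z.
by move=> /overlap_dom[].
Qed.

Lemma near_tm_slit u : slit u -> near_tm u slit.
Proof.
move=> u0 c Ac cu; have z0 : (tm_coord c u).2 != 0.
  apply: contra_neq u0 => h; rewrite -(vec_coordK u.2 Ac cu).
  by rewrite -[vec_coord _ _ _]/((tm_coord c u).2) h vec_ofE derive0.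
have sc : z.2 @[z --> tm_coord c u] --> (tm_coord c u).2 by exact: cvg_snd.
have := near_comp sc (near_neq0 z0).
apply: filterS2 (near_tm_overlap (tm_overlap_coord A cu cu)) => z /overlap_dom[cz _] z20.
exact: vec_of_neq0.
Qed.

Lemma fun_smooth_near (f g : TM -> R) u :
  near_tm u (fun q => f q = g q) -> fun_smooth_at A f u -> fun_smooth_at A g u.
Proof.
move=> fg fu c Ac cu; apply: smooth_at_near (fu c Ac cu); exact: fg.
Qed.

Lemma pi_smooth_near (s t : TM -> E) u :
  near_tm u (fun q => s q = t q) -> pi_smooth_at A s u -> pi_smooth_at A t u.
Proof.
move=> st su c Ac cu; apply: smooth_at_near (su c Ac cu).
by apply: filterS (st c Ac cu) => z; rewrite /pi_rep => ->.
Qed.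

Lemma fun_smooth_cst (a : R) u : fun_smooth_at A (fun=> a) u.
Proof.
move=> c Ac cu; exists setT; split=> //; first exact: openT.
exact: smooth_on_cst.
Qed.

Lemma eta_smooth u : pi_smooth_at A (@eta R n M) u.
Proof.
move=> c Ac cu; exists (tm_overlap c c); split.
- exact: tm_overlap_open.
- exact: tm_overlap_coord.
have fs2 : smooth_on (tm_overlap c c) (pair2 E E).
  by apply: smooth_on_lin => z; exact: cvg_snd.
apply: (smooth_on_eq _ _ (@tm_overlap_open _ _ _ c c) _ fs2) => z /overlap_dom[cz _].
by rewrite /pi_rep /eta /= vec_ofK.
Qed.

Lemma pi_smooth_vec_of c a u : in_atlas A c -> cdom c u.1 ->
  pi_smooth_at A (fun q => vec_of c q.1 a) u.
Proof.
move=> Ac cu c' Ac' c'u; exists (tm_overlap c' c); split.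
- exact: tm_overlap_open.
- exact: tm_overlap_coord.
have oU := @tm_overlap_open R n M c' c; have oo := @overlap_open R n M c' c.
have fs1 : smooth_on (tm_overlap c' c) (pair1 E E).
  by apply: smooth_on_lin => z; exact: cvg_fst.
have f1 : smooth_on (tm_overlap c' c) (trans c' c \o pair1 E E).
  exact: (smooth_on_comp _ _ _ oU oo (fun _ h => h) (trans_smooth Ac' Ac) fs1).
have f2 : smooth_on (tm_overlap c' c) ('D_a (trans c c') \o (trans c' c \o pair1 E E)).
  apply: (smooth_on_comp _ _ _ oU (@overlap_open R n M c c') _ _ f1).
    by move=> z /overlap_dom[c'z cz]; exact: overlap_map.
  exact: (smooth_on_derive a (trans_smooth Ac Ac')).
apply: (smooth_on_eq _ _ oU _ f2) => z /overlap_dom[c'z cz].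
by rewrite /pi_rep /= vec_coord_of.
Qed.

Lemma fun_smooth_component c (s : TM -> E) i u : in_atlas A c -> cdom c u.1 ->
  pi_smooth_at A s u -> fun_smooth_at A (fun q => vec_coord c q.1 (s q) 0 i) u.
Proof.
move=> Ac cu su c' Ac' c'u; have [U [oU Uu sU]] := su c Ac cu.
have oU' : open (tm_overlap c' c `&` tm_trans c' c @^-1` U).
  apply: (open_preimage_on _ oU); first exact: tm_overlap_open.
  by move=> z zo; exact: differentiable_continuous (tm_trans_diff Ac' Ac zo).
exists (tm_overlap c' c `&` tm_trans c' c @^-1` U); split=> //.
  split; first exact: tm_overlap_coord.
  by rewrite /= (tm_trans_coord Ac' Ac).
have f1 : smooth_on (tm_overlap c' c `&` tm_trans c' c @^-1` U) (tm_trans c' c).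
  by apply: smooth_on_sub (tm_trans_smooth Ac' Ac) => z [].
have f2 : smooth_on (tm_overlap c' c `&` tm_trans c' c @^-1` U)
    (pi_rep A c s \o tm_trans c' c).
  exact: (smooth_on_comp _ _ _ oU' oU (fun z h => h.2) sU f1).
apply: (smooth_on_eq _ _ oU' _
  (smooth_on_lin_comp _ _ _ oU' (coord_rV_cont (i := i)) f2)) => z [zo _] /=.
have [c'z cz] := overlap_dom zo.
rewrite /pi_rep -(tm_coord_of Ac' Ac zo) (tm_coordK Ac); last exact: cz.
by rewrite [cinv c _](chartK cz).
Qed.

Lemma vf_smooth_rho (X : TM -> E * E) u : vf_smooth_at A X u -> pi_smooth_at A (rho \o X) u.
Proof.
move=> Xu c Ac cu; have [U [oU Uu XU]] := Xu c Ac cu.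
have lc : continuous (pair1 E E) by move=> z; exact: cvg_fst.
apply: (@smooth_at_near _ _ _ _ _ (pair1 E E \o vf_rep A c X)).
  apply: filterS (near_tm_overlap (tm_overlap_coord A cu cu)) => z /overlap_dom[cz _].
  by rewrite /= /vf_rep tvec_coord1.
by exists U; split=> //; exact: (smooth_on_lin_comp _ _ _ oU lc XU).
Qed.

(** The coordinate vector fields of a chart, multiplied by a bump function of
the base point. The support of the bump is compact in the chart domain, hence
closed in a Hausdorff manifold, and extension by zero is smooth. *)
Lemma bump_fields p : hausdorff_space M -> exists chi : M -> R, chi p = 1 /\
  (forall p', ~ cdom (chart_at p) p' -> chi p' = 0) /\
  forall w, vector_field A (fun q => chi q.1 *: tvec_of A (chart_at p) q w).
Proof.
move=> HM; set c := chart_at p.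
have Ac : in_atlas A c by exact: chart_at_atlas.
have cp : cdom c p by exact: chart_at_dom.
have [b [K [bs b1 cK KU bK]]] :=
  bump_function (@cimg_open _ _ _ c) (ex_intro2 _ _ p cp erefl).
(* The support in the manifold, described both ways, and closed. *)
have [cinvK cKM] : cdom c `&` cmap c @^-1` K = cinv c @` K /\ closed (cinv c @` K).
  split.
    apply/seteqP; split=> q; first by move=> [cq Kq]; exists (cmap c q); rewrite ?chartK.
    by move=> [x Kx <-]; have [q' cq' xE] := KU _ Kx; rewrite -xE /= chartK//; split=> //=;
      rewrite xE.
  apply: compact_closed => //; apply: continuous_compact => //.
  apply: continuous_in_subspaceT => x; rewrite inE => /KU cx; exact: cinv_cts.
pose chi p' := if pselect (cdom c p') is left _ then b (cmap c p') else 0.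
have chiE p' : cdom c p' -> chi p' = b (cmap c p') by rewrite /chi; case: pselect.
have chi0 p' : ~ (cinv c @` K) p' -> chi p' = 0.
  rewrite -cinvK /chi; case: pselect => // cq nK; apply: bK => Kq; exact: nK.
exists chi; split; first by rewrite chiE.
split; first by rewrite /chi => p' ?; case: pselect.
move=> w u _ c' Ac' c'u.
(* Outside the support the field is zero near the point; on it the field is
   read in the chart of the bump function. *)
have [Ku|nKu] := pselect ((cinv c @` K) u.1); last first.
  exists (tm_overlap c' c' `&` (cinv c' \o fst) @^-1` (~` (cinv c @` K))); split.
  - apply: open_preimage_on; [exact: tm_overlap_open|exact: closed_openC|].
    move=> z zo; apply: continuous_comp; first exact: cvg_fst.
    by apply: cinv_cts; have [] := (overlapP c' c' z.1).1 zo.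
  - by split; [exact: tm_overlap_coord|rewrite /= chartK].
  apply: (@smooth_on_eq _ _ _ _ _ _ (fun=> 0)).
  - apply: open_preimage_on; [exact: tm_overlap_open|exact: closed_openC|].
    move=> z zo; apply: continuous_comp; first exact: cvg_fst.
    by apply: cinv_cts; have [] := (overlapP c' c' z.1).1 zo.
  - move=> z [/overlap_dom[c'z _] nKz]; rewrite /vf_rep chi0//= scale0r.
    by rewrite tvec_coordE// derive0.
  - exact: smooth_on_cst.
have cu : cdom c u.1 by move: Ku; rewrite -cinvK => -[].
have oU := @tm_overlap_open R n M c' c; have oo := @overlap_open R n M c' c.
exists (tm_overlap c' c); split=> //; first exact: tm_overlap_coord.
have f1 : smooth_on (tm_overlap c' c) (trans c' c \o fst).
  apply: (smooth_on_comp _ _ _ oU oo (fun _ h => h) (trans_smooth Ac' Ac)).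
  by apply: (@smooth_on_lin _ _ _ _ _ _ (pair1 E E)) => z; exact: cvg_fst.
have f2 : smooth_on (tm_overlap c' c) (b \o (trans c' c \o fst)).
  exact: (smooth_on_comp _ _ _ oU openT (fun _ _ => I) bs f1).
have f3 : smooth_on (tm_overlap c' c) ('D_w (tm_trans c c') \o tm_trans c' c).
  apply: (smooth_on_comp _ _ _ oU (@tm_overlap_open R n M c c') _ _ (tm_trans_smooth Ac' Ac)).
    by move=> z /overlap_dom[c'z cz]; exact: overlap_map.
  exact: (smooth_on_derive w (tm_trans_smooth Ac Ac')).
apply: (smooth_on_eq _ _ oU _ (smooth_onZ _ _ oU f2 f3)) => z zo.
have [c'z cz] := overlap_dom zo.
have c'q : cdom c' (tm_of c' z).1 by [].
have cq : cdom c (tm_of c' z).1 by [].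
rewrite /vf_rep (tvec_coordZ _ _ Ac' c'q) (chiE _ cq) (tvec_coord_of _ Ac Ac' cq c'q).
by rewrite (tm_coord_of Ac' Ac zo).
Qed.

End SmoothSections.

(** * Restriction to the fibres *)

Section Fibres.
Context {R : realType} {n : nat} {M : topologicalType}.
Variable (A : smooth_atlas R n M).

Local Notation E := ('rV[R]_n).
Local Notation TM := (M * 'rV[R]_n)%type.
Local Notation chart := (chart R n M).
Local Notation chart_at := (chart_at A).
Local Notation vec_of := (vec_of A).
Local Notation vec_coord := (vec_coord A).
Local Notation tm_of := (tm_of A).
Local Notation tm_coord := (tm_coord A).
Local Notation slit := (@slit R n M).
Implicit Types (c : chart) (p : M) (u q : TM) (x y v a b : E) (z w : E * E).

Lemma derive_vert (W : normedModType R) (f : E * E -> W) x y b :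
  'D_(0, b) f (x, y) = 'D_b (fun y' => f (x, y')) y.
Proof.
apply: derive_along => h; rewrite (_ : h *: (0, b) + (x, y) = (x, h *: b + y))//.
by congr pair; rewrite /= scaler0 add0r.
Qed.

Lemma derive_horiz (W : normedModType R) (f : E * E -> W) x y a :
  'D_(a, 0) f (x, y) = 'D_a (fun x' => f (x', y)) x.
Proof.
apply: derive_along => h; rewrite (_ : h *: (a, 0) + (x, y) = (h *: a + x, y))//.
by congr pair; rewrite /= scaler0 add0r.
Qed.

Lemma tderive_vert (W : normedModType R) (f : TM -> W) p y b :
  tderive A (p, y) (0, b) f = 'D_b (fun y' => f (p, y')) y.
Proof.
rewrite /tderive tm_coord_at derive_vert /=; congr ('D__ _ _).
by apply/funext => y'; rewrite /= tm_of_at.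
Qed.

Lemma tderive_horiz (W : normedModType R) (f : TM -> W) p y a :
  tderive A (p, y) (a, 0) f =
  'D_a (fun x => f (Defs.tm_of A (chart_at p) (x, y))) (cmap (chart_at p) p).
Proof. by rewrite /tderive tm_coord_at derive_horiz. Qed.

(** Near a nonzero vector all vectors are nonzero, so values at zero vectors do
not matter. *)
Lemma tderive_slit0 u w (f : TM -> R) : slit u -> (forall q, slit q -> f q = 0) ->
  tderive A u w f = 0.
Proof.
move=> u0 fq; rewrite /tderive -[RHS](derive_cst (0 : R) (tm_coord (chart_at u.1) u) w).
apply: near_eq_derive.
apply: filterS (near_tm_slit u0 (chart_at_atlas A u.1) (chart_at_dom A u.1)) => z.
exact: fq.
Qed.

Lemma vf_rep_fibre (Y : TM -> E * E) p y :
  vf_rep A (chart_at p) Y (cmap (chart_at p) p, y) = Y (p, y).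
Proof. by rewrite /vf_rep tm_of_at; exact: (tvec_coord_at A (p, y)). Qed.

(** If the derivative does not exist, for want of regularity of the second
component, it is zero because the limit of a divergent filter defaults to zero.
In this way the torsion of sections that are constant along the fibres is computed
before the horizontal lift is known to be differentiable. *)
Lemma derive_pair1_line (V : normedModType R) (f : V -> E * E) (x v : V) (k : E) :
  (\forall h \near (0 : R), (f (h *: v + x)).1 = k) -> ('D_v f x).1 = 0.
Proof.
move=> fk; have [fd|nfd] := pselect (derivable f x v); last first.
  by rewrite /derive dvgP//; apply/matrixP => i j; rewrite !mxE.
rewrite derive_pair1//; suff [] : is_derive x v (fst \o f) 0 by [].
have k0 : (f x).1 = k by have := nbhs_singleton fk; rewrite scale0r add0r.
apply/is_deriveP => e e0; apply: filterS fk => h hk.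
by rewrite /= hk k0 subrr scaler0 subr0 normr0 mulr_ge0// ltW.
Qed.

Lemma smooth_at_vert (W : normedModType R) (cW : coordinates W) (f : E * E -> W) x y :
  smooth_at (x, y) f -> smooth_at y (fun y' => f (x, y')).
Proof.
move=> [U [oU Uxy fU]].
have ic : continuous (fun y' : E => (x, y')).
  by move=> y'; exact/differentiable_continuous/differentiable_pair.
have oU' : open ((fun y' : E => (x, y')) @^-1` U).
  by apply: open_comp => // y' _; exact: ic.
exists ((fun y' : E => (x, y')) @^-1` U); split=> //.
have incl : smooth_on ((fun y' : E => (x, y')) @^-1` U) (fun y' : E => (x, y')).
  apply: (smooth_on_pair _ _ _ oU'); first exact: smooth_on_cst.
  by apply: (@smooth_on_lin _ _ _ _ _ _ (idfun : {linear E -> E})) => y'; exact: cvg_id.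
exact: (smooth_on_comp _ _ _ oU' oU (fun _ h => h) fU incl).
Qed.

Lemma pi_smooth_fibre (s : TM -> E) p y :
  pi_smooth_at A s (p, y) -> smooth_at y (fun y' => s (p, y')).
Proof.
move=> /(_ _ (chart_at_atlas A p) (chart_at_dom A p)); rewrite tm_coord_at.
move=> /smooth_at_vert; rewrite (_ : (fun y' => _) = fun y' => s (p, y'))//.
apply/funext => y'; rewrite /pi_rep tm_of_at /= chartK; last exact: chart_at_dom.
by rewrite vec_coord_at.
Qed.

Lemma fun_smooth_fibre (f : TM -> R) p y :
  fun_smooth_at A f (p, y) -> smooth_at y (fun y' => f (p, y')).
Proof.
move=> /(_ _ (chart_at_atlas A p) (chart_at_dom A p)); rewrite tm_coord_at.
move=> /smooth_at_vert; rewrite (_ : (fun y' => _) = fun y' => f (p, y'))//.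
by apply/funext => y'; rewrite /= tm_of_at.
Qed.

Lemma pi_smooth_scale (f : TM -> R) (s : TM -> E) u :
  fun_smooth_at A f u -> pi_smooth_at A s u -> pi_smooth_at A (fun q => f q *: s q) u.
Proof.
move=> fu su c Ac cu.
have : smooth_at (tm_coord c u) (fun z => f (tm_of c z) *: pi_rep A c s z).
  apply: smooth_at_binary (fu c Ac cu) (su c Ac cu) => U oU fU sU.
  exact: (smooth_onZ _ _ oU fU sU).
apply: smooth_at_near.
apply: filterS (near_tm_overlap (tm_overlap_coord A cu cu)) => z /overlap_dom[cz _].
rewrite /pi_rep; have := vec_coord_lin Ac cz (f (tm_of c z)) (s (tm_of c z)) 0.
by rewrite [vec_coord _ _ 0]derive0 !addr0.
Qed.

Lemma pi_smooth_add (s t : TM -> E) u :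
  pi_smooth_at A s u -> pi_smooth_at A t u -> pi_smooth_at A (fun q => s q + t q) u.
Proof.
move=> su tu c Ac cu.
have : smooth_at (tm_coord c u) (fun z => pi_rep A c s z + pi_rep A c t z).
  apply: smooth_at_binary (su c Ac cu) (tu c Ac cu) => U oU sU tU.
  exact: (smooth_onD _ _ oU sU tU).
apply: smooth_at_near.
apply: filterS (near_tm_overlap (tm_overlap_coord A cu cu)) => z /overlap_dom[cz _].
by rewrite /pi_rep; have := vec_coord_lin Ac cz 1 (s (tm_of c z)) (t (tm_of c z));
  rewrite !scale1r.
Qed.

Lemma pi_smooth0 u : pi_smooth_at A (fun=> 0) u.
Proof.
(* The zero section as zero times the fundamental section. *)
have := pi_smooth_scale (@fun_smooth_cst _ _ _ A 0 u) (@eta_smooth _ _ _ A u).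
by under eq_fun do rewrite scale0r.
Qed.

Lemma pi_smooth_sum (I : Type) (r : seq I) (F : I -> TM -> E) u :
  (forall i, pi_smooth_at A (F i) u) ->
  pi_smooth_at A (fun q => \sum_(i <- r) F i q) u.
Proof.
move=> Fu; elim: r => [|i r IH].
  by under eq_fun do rewrite big_nil; exact: pi_smooth0.
by under eq_fun do rewrite big_cons; exact: (pi_smooth_add (Fu i) IH).
Qed.

Lemma tm_trans_vert c c' (z : E * E) (v : E) : in_atlas A c -> in_atlas A c' ->
  tm_overlap c c' z -> 'D_(0, v) (tm_trans c c') z = (0, 'D_v (trans c c') z.1).
Proof.
case: z => x y Ac Ac' zo; rewrite derive_vert.
suff [] : is_derive y v (fun y' => tm_trans c c' (x, y')) (0, 'D_v (trans c c') x) by [].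
apply/is_deriveP => e e0; near=> h.
have td := trans_diff Ac Ac' zo.
rewrite [X in `|X|](_ : _ = 0) ?normr0 ?mulr_ge0 ?(ltW e0)//.
rewrite /tm_trans /= !(deriveE _ td) linearP; congr pair => /=.
  by rewrite subrr scaler0 subr0.
by rewrite addrK subrr.
Unshelve. all: by end_near. Qed.

Lemma vlift_smooth (X : M * E -> E) u : pi_smooth_at A X u -> vf_smooth_at A (vlift X) u.
Proof.
move=> Xu c Ac cu; have [U [oU Uu XU]] := Xu c Ac cu.
apply: (@smooth_at_near _ _ _ _ _ (fun z => (0, pi_rep A c X z))).
  apply: filterS (near_tm_overlap (tm_overlap_coord A cu cu)) => z /overlap_dom[cz _].
  set q := tm_of c z; have cq : cdom c q.1 := cz.
  rewrite /vf_rep (tvec_coordE _ Ac cq) (tm_trans_vert _ (chart_at_atlas A q.1) Ac)//.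
  by apply: tm_overlap_coord => //; exact: chart_at_dom.
exists U; split=> //; exact: (smooth_on_pair _ _ _ oU (smooth_on_cst _ _ 0) XU).
Qed.

(** Expansion in the coordinate frame of [c]. It holds on the whole domain of
[c], which allows the Leibniz rule to be applied to it. *)
Lemma section_frame c (s : TM -> E) q : in_atlas A c -> cdom c q.1 ->
  s q = \sum_i vec_coord c q.1 (s q) 0 i *: frame A c i q.
Proof.
move=> Ac cq; rewrite -{1}(vec_coordK (s q) Ac cq) {1}(row_sum_delta (vec_coord c q.1 (s q))).
have l0 : vec_of c q.1 0 = 0 by exact: derive0.
have lD x y : vec_of c q.1 (x + y) = vec_of c q.1 x + vec_of c q.1 y.
  by have := vec_of_lin Ac cq 1 x y; rewrite !scale1r.
rewrite (big_morph _ lD l0); apply: eq_bigr => i _.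
by have := vec_of_lin Ac cq (vec_coord c q.1 (s q) 0 i) (delta_mx 0 i) 0;
  rewrite l0 !addr0.
Qed.

(** * Linear connections in the vertical directions *)

Section LinearConnection.
Variable D : TM -> E * E -> (TM -> E) -> E.
Hypothesis HD : linear_connection A D.

(** Locality follows from the Leibniz rule: multiply both sections by a function
that vanishes where they differ. *)
Lemma conn_local u w (s t : TM -> E) : slit u -> pi_smooth_at A s u ->
  near_tm A u (fun q => s q = t q) -> D u w s = D u w t.
Proof.
move=> u0 su st; have [_ _ DL _] := HD.
have tu : pi_smooth_at A t u := pi_smooth_near st su.
have stu : s u = t u := near_tm_self st.
(* The indicator of the set where [s] and [t] agree is smooth at [u] because
   it is constantly one near [u]. *)
pose f q : R := (s q == t q)%:R.
have fu : f u = 1 by rewrite /f stu eqxx.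
have fS : fun_smooth_at A f u.
  apply: (fun_smooth_near (f := fun=> 1)); last exact: fun_smooth_cst.
  by apply: near_tmW st => q sq; rewrite /f sq eqxx.
have : D u w (fun q => f q *: s q) = D u w (fun q => f q *: t q).
  congr (D u w _); apply/funext => q; rewrite /f; case: eqP => [->//|_].
  by rewrite !scale0r.
by rewrite !DL// fu !scale1r stu => /addrI.
Qed.

Lemma connD u w w' (s : TM -> E) : slit u -> pi_smooth_at A s u ->
  D u (w + w') s = D u w s + D u w' s.
Proof. by move=> u0 su; have [/(_ u 1 w w' s u0 su) + _ _ _] := HD; rewrite !scale1r. Qed.

Lemma conn0 u (s : TM -> E) : slit u -> pi_smooth_at A s u -> D u 0 s = 0.
Proof.
by move=> u0 su; apply: (@addrI _ (D u 0 s)); rewrite -connD// !addr0.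
Qed.

Lemma connZ u (k : R) w (s : TM -> E) : slit u -> pi_smooth_at A s u ->
  D u (k *: w) s = k *: D u w s.
Proof.
move=> u0 su; have [/(_ u k w 0 s u0 su) + _ _ _] := HD.
by rewrite conn0// !addr0.
Qed.

Lemma conn_sum_dir u (I : Type) (r : seq I) (W : I -> E * E) (s : TM -> E) :
  slit u -> pi_smooth_at A s u ->
  D u (\sum_(i <- r) W i) s = \sum_(i <- r) D u (W i) s.
Proof.
move=> u0 su; elim: r => [|i r IH]; first by rewrite !big_nil conn0.
by rewrite !big_cons connD// IH.
Qed.

Lemma conn_section0 u w : slit u -> D u w (fun=> 0) = 0.
Proof.
move=> u0; have [_ /(_ u w _ _ u0 (@pi_smooth0 u) (@pi_smooth0 u)) + _ _] := HD.
rewrite (_ : (fun=> 0 + 0) = fun=> 0) => [h|]; last by apply/funext => q; rewrite addr0.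
by apply: (@addrI _ (D u w (fun=> 0))); rewrite -h addr0.
Qed.

Lemma conn_section_sum u w (I : Type) (r : seq I) (f : I -> TM -> R) (s : I -> TM -> E) :
  slit u -> (forall i, fun_smooth_at A (f i) u) -> (forall i, pi_smooth_at A (s i) u) ->
  D u w (fun q => \sum_(i <- r) f i q *: s i q) =
  \sum_(i <- r) (tderive A u w (f i) *: s i u + f i u *: D u w (s i)).
Proof.
move=> u0 fu su; have [_ DA DL _] := HD; elim: r => [|i r IH].
  by under eq_fun do rewrite big_nil; rewrite big_nil conn_section0.
under eq_fun do rewrite big_cons; rewrite big_cons DA//; first by rewrite DL// IH.
  exact: (pi_smooth_scale (fu i) (su i)).
by apply: pi_smooth_sum => j; exact: (pi_smooth_scale (fu j) (su j)).
Qed.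

(** The vertical Christoffel symbols of the connection: the derivative, in the
vertical direction [b], of the section whose components near [u] in the
preferred chart are constantly [a]. *)
Definition vert_coeff u b a : E :=
  \sum_i a 0 i *: D u (0, b) (frame A (chart_at u.1) i).

(** Along the fibre over [p] components in the preferred chart at [p] are
the vectors themselves, so the Leibniz rule applied to [section_frame] separates
the derivative of the components from the Christoffel symbols. *)
Lemma conn_vert (s : TM -> E) p y b : y != 0 -> pi_smooth_at A s (p, y) ->
  D (p, y) (0, b) s = 'D_b (fun y' => s (p, y')) y + vert_coeff (p, y) b (s (p, y)).
Proof.
move=> y0 su; set c := chart_at p.
have Ac : in_atlas A c by exact: chart_at_atlas.
have cp : cdom c p by exact: chart_at_dom.
have sE : near_tm A (p, y) (fun q => s q = \sum_i vec_coord c q.1 (s q) 0 i *: frame A c i q).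
  by apply: near_tmW (near_tm_dom (u := (p, y)) Ac cp) => q cq; exact: section_frame.
have slu : slit (p, y) := y0.
have fu i : fun_smooth_at A (fun q => vec_coord c q.1 (s q) 0 i) (p, y).
  exact: (fun_smooth_component i Ac (u := (p, y)) cp su).
have wu i : pi_smooth_at A (frame A c i) (p, y).
  exact: (pi_smooth_vec_of _ Ac (u := (p, y)) cp).
rewrite (conn_local _ slu su sE) (conn_section_sum _ _ slu fu wu).
rewrite big_split /=; congr (_ + _); last first.
  by apply: eq_bigr => i _; rewrite vec_coord_at.
have sd : derivable (fun y' => s (p, y')) y b.
  exact/diff_derivable/smooth_at_diff/pi_smooth_fibre.
rewrite (row_sum_delta ('D_b (fun y' => s (p, y')) y)); apply: eq_bigr => i _.
rewrite tderive_vert /frame /= vec_of_at derive_mx// mxE.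
rewrite (_ : (fun y' => _) = fun y' => s (p, y') 0 i)//.
by apply/funext => y'; rewrite vec_coord_at.
Qed.

End LinearConnection.
End Fibres.

(** * Fibre Hessian of a homogeneous function *)

Section FibreHessian.
Context {R : realType} {n : nat}.
Local Notation E := ('rV[R]_n).

Definition nonzero : set E := [set y | y != 0].

Lemma nonzero_open : open nonzero.
Proof. by rewrite openE => y y0; apply: filterS (near_neq0 y0). Qed.

Variable F : E -> R.
Hypothesis Fs : smooth_on nonzero F.
Hypothesis FH : forall (k : R) y, 0 < k -> y != 0 -> F (k *: y) = k ^+ 2 * F y.

(** Half of it is the Finsler metric when [F] is the square of the Finsler
function. The lemmas below ask for homogeneity of degree two, thus [hess] is of
degree zero and its derivatives are of degree [-1]. *)
Definition hess v w : E -> R := 'D_v ('D_w F).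

Lemma hess_smooth v w : smooth_on nonzero (hess v w).
Proof. by do 2 apply: smooth_on_derive. Qed.

Lemma smooth_nonzero_diff (h : E -> R) y : smooth_on nonzero h -> y != 0 ->
  differentiable h y.
Proof. by move=> hs y0; exact: (smooth_differentiable _ _ nonzero_open hs). Qed.

Lemma derive_lin (h : E -> R) y : smooth_on nonzero h -> y != 0 ->
  linear (fun v => 'D_v h y).
Proof.
by move=> hs y0 a v w; rewrite !(deriveE _ (smooth_nonzero_diff hs y0)) linearP.
Qed.

Lemma hess_linl w y : y != 0 -> linear (fun v => hess v w y).
Proof. by move=> y0; apply: derive_lin => //; exact: smooth_on_derive. Qed.

Lemma hess_sym v w y : y != 0 -> hess v w y = hess w v y.
Proof. by move=> y0; exact: (derive_commute _ _ _ nonzero_open Fs). Qed.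

Lemma hess_commute b v w y : y != 0 -> 'D_b (hess v w) y = 'D_v (hess b w) y.
Proof.
by move=> y0; apply: (derive_commute _ _ _ nonzero_open (smooth_on_derive w Fs)).
Qed.

Lemma derive_homogeneous (h : E -> R) (k m : R) b y : smooth_on nonzero h ->
  0 < k -> (forall y', y' != 0 -> h (k *: y') = m * h y') -> y != 0 ->
  'D_b h (k *: y) = m / k * 'D_b h y.
Proof.
move=> hs k0 hk y0; have kn0 : k != 0 by rewrite gt_eqF.
have ky0 : k *: y != 0 by rewrite scaler_eq0 negb_or kn0.
have hd := smooth_nonzero_diff hs y0; have hkd := smooth_nonzero_diff hs ky0.
have h1 : 'D_b (fun y' => h (k *: y')) y = k * 'D_b h (k *: y).
  have -> : 'D_b (fun y' => h (k *: y')) y = 'D_(k *: b) h (k *: y).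
    by apply: derive_along => t; rewrite scalerDr !scalerA [k * t]mulrC.
  by rewrite !(deriveE _ hkd) linearZ.
have h2 : 'D_b (fun y' => h (k *: y')) y = m * 'D_b h y.
  rewrite (near_eq_derive (g := m \*: h)).
    by rewrite deriveZ//; exact: diff_derivable.
  by apply: filterS (near_neq0 y0) => y'; exact: hk.
by rewrite mulrAC -h2 h1 mulrAC mulfV// mul1r.
Qed.

Lemma hess_homogeneous (k : R) v w y : 0 < k -> y != 0 -> hess v w (k *: y) = hess v w y.
Proof.
move=> k0 y0; have kn0 : k != 0 by rewrite gt_eqF.
have D1 y' : y' != 0 -> 'D_w F (k *: y') = k * 'D_w F y'.
  move=> y'0; rewrite (derive_homogeneous w Fs k0 (m := k ^+ 2))//.
    by rewrite expr2 mulfK.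
  by move=> z; exact: FH.
rewrite /hess (derive_homogeneous v (smooth_on_derive w Fs) k0 D1 y0).
by rewrite mulfV// mul1r.
Qed.

Lemma derive_hess_homogeneous (k : R) b v w y : 0 < k -> y != 0 ->
  'D_b (hess v w) (k *: y) = k^-1 * 'D_b (hess v w) y.
Proof.
move=> k0 y0.
rewrite (derive_homogeneous b (hess_smooth v w) k0 (m := 1)) ?mul1r// => y' y'0.
by rewrite hess_homogeneous// mul1r.
Qed.

(** Euler's identity in degree zero. *)
Lemma derive_hess_radial v w y : y != 0 -> 'D_y (hess v w) y = 0.
Proof.
move=> y0; suff [] : is_derive y y (hess v w) 0 by [].
apply/is_deriveP => e e0.
have : \forall t \near (0 : R), `|t| < 1 by exact: nbhs0_lt.
apply: filterS => t t1; have t0 : 0 < t + 1.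
  by rewrite -ltrBlDr sub0r; move: t1; rewrite ltr_norml => /andP[].
have -> : t *: y + y = (t + 1) *: y by rewrite scalerDl scale1r.
rewrite hess_homogeneous//.
by rewrite subrr scaler0 subr0 normr0 mulr_ge0// ltW.
Qed.

Lemma derive_hess_radial2 b w y : y != 0 -> 'D_b (hess y w) y = 0.
Proof. by move=> y0; rewrite hess_commute// derive_hess_radial. Qed.

(** Let the third derivative [C] be constant along a ray [y + t r] that avoids
the origin. By homogeneity [C y = C (y + r/s) = s C (r + s y)] for all [s > 0],
and the right-hand side tends to [0 * C r] as [s] tends to zero. *)
Lemma derive_hess_ray b v w y r : y != 0 -> r != 0 ->
  (forall t : R, 0 <= t -> y + t *: r != 0) ->
  (forall t : R, 0 <= t -> 'D_r ('D_b (hess v w)) (y + t *: r) = 0) ->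
  'D_b (hess v w) y = 0.
Proof.
move=> y0 r0 yr0 Dr; have Cs : smooth_on nonzero ('D_b (hess v w)).
  exact: smooth_on_derive (hess_smooth v w).
have Cray (t : R) : 0 < t -> 'D_b (hess v w) (y + t *: r) = 'D_b (hess v w) y.
  move=> t0; apply: (@constant_dir R _ ('D_b (hess v w)) y (t *: r)) => s /andP[s0 s1].
  have st0 : 0 <= s * t by rewrite mulr_ge0// ltW.
  rewrite (_ : s *: (t *: r) = (s * t) *: r); last by rewrite scalerA.
  apply: is_derive_dir0 (Dr _ st0).
  exact: diff_derivable (smooth_nonzero_diff Cs (yr0 _ st0)).
have Cs0 (s : R) : 0 < s -> 'D_b (hess v w) y = s * 'D_b (hess v w) (r + s *: y).
  move=> s0; have s'0 : 0 < s^-1 by rewrite invr_gt0.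
  have yE : y + s^-1 *: r = s^-1 *: (r + s *: y).
    by rewrite scalerDr scalerK ?gt_eqF// addrC.
  have rs0 : r + s *: y != 0.
    by have := yr0 _ (ltW s'0); rewrite yE; apply: contra_neq => ->; rewrite scaler0.
  by rewrite -(Cray _ s'0) yE (derive_hess_homogeneous b v w s'0 rs0) invrK.
set C := 'D_b (hess v w) in Cs0 *.
have cC : C z @[z --> r] --> C r.
  exact: differentiable_continuous (smooth_nonzero_diff Cs r0).
have cr : r + s *: y @[s --> (0 : R)] --> r.
  rewrite -[X in _ --> X]addr0 -[X in _ --> _ + X](scale0r y).
  by apply: cvgD; [exact: cvg_cst | exact: scalel_continuous].
(* Both sides of [C y = s C (r + s y)] are compared as [s] tends to [0^+]. *)
have lim0 : s * C (r + s *: y) @[s --> (0 : R)^'+] --> (0 : R).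
  rewrite -[X in _ --> X](mul0r (C r)); apply: cvg_at_right_filter.
  by apply: cvgM; [exact: cvg_id | exact: (cvg_comp _ _ cr cC)].
have limC : s * C (r + s *: y) @[s --> (0 : R)^'+] --> C y.
  apply: cvg_near_cst; near=> s; apply/eqP; rewrite eq_sym -Cs0//.
exact: (cvg_unique _ limC lim0).
Unshelve. all: by end_near. Qed.

End FibreHessian.

(** * The Finsler metric *)

Section Metric.
Context {R : realType} {n : nat} {M : topologicalType}.
Variable (A : smooth_atlas R n M).

Local Notation E := ('rV[R]_n).
Local Notation TM := (M * 'rV[R]_n)%type.
Local Notation chart_at := (chart_at A).
Local Notation slit := (@slit R n M).
Implicit Types (p : M) (u q : TM) (x y v w a b e : E).

(** The axioms of a Cartan connection and of a concurrent field speak of fields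
on the whole slit tangent bundle. These fields allow them to be applied to
arbitrary vectors over [p]. The fields [X (0, b)] are vertical everywhere, and
the sections [s a] are constant along all fibres. *)
Lemma prescribed_fields p : hausdorff_space M ->
  exists (X : E * E -> TM -> E * E) (s : E -> M -> E),
  [/\ forall w : E * E, vector_field A (X w),
      forall a, pi_field A (fun q => s a q.1),
      forall (w : E * E) y, X w (p, y) = w,
      forall a, s a p = a
    & forall b q, (X (0, b) q).1 = 0].
Proof.
move=> HM; have [chi [chi1 [chi0 Xs]]] := bump_fields A p HM.
set c := chart_at p in chi0 Xs.
have Ac : in_atlas A c by exact: chart_at_atlas.
pose X (w : E * E) q := chi q.1 *: tvec_of A c q w.
pose s a p' := chi p' *: vec_of A c p' a.
have rX (w : E * E) q : (X w q).1 = s w.1 q.1.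
  rewrite /X /s; have [cq|ncq] := pselect (cdom c q.1).
    by rewrite -(rho_tvec_of w Ac cq).
  by rewrite chi0//= !scale0r.
exists X, s; split.
- exact: Xs.
- move=> a u u0; have := vf_smooth_rho (Xs (a, 0) u u0).
  rewrite (_ : rho \o _ = fun q => s a q.1)//; apply/funext => q.
  exact: (rX (a, 0) q).
- by move=> w y; rewrite /X chi1 scale1r; exact: (tvec_of_at A (p, y) w).
- by move=> a; rewrite /s chi1 scale1r vec_of_at.
- by move=> b q; rewrite rX /s [vec_of _ _ _ _]derive0 scaler0.
Qed.

Variable L : TM -> R.
Hypothesis HF : finsler A L.

Lemma energy_smooth p : smooth_on nonzero (fun y => L (p, y) ^+ 2).
Proof.
move=> y y0; have [Ls _ _ _] := HF.
have [U [oU Uy LU]] := fun_smooth_fibre (Ls (p, y) y0).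
have : smooth_on U (fun y => L (p, y) ^+ 2).
  by under eq_fun do rewrite expr2; exact: (smooth_onM _ oU LU LU).
exact.
Qed.

Lemma energy_homogeneous p (k : R) y : 0 < k -> y != 0 ->
  L (p, k *: y) ^+ 2 = k ^+ 2 * L (p, y) ^+ 2.
Proof. by move=> k0 _; have [_ _ Lh _] := HF; rewrite Lh ?(ltW k0)// exprMn. Qed.

Lemma metricE p y v w : metric L (p, y) v w = hess (fun y => L (p, y) ^+ 2) v w y / 2.
Proof. by []. Qed.

Lemma metric_symm u v w : slit u -> metric L u v w = metric L u w v.
Proof.
case: u => p y u0; rewrite [LHS]metricE [RHS]metricE.
by rewrite (hess_sym (energy_smooth p) v w u0).
Qed.

Lemma metric_linl u w : slit u -> linear (fun v => metric L u v w).
Proof.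
case: u => p y u0 a v v'; rewrite [LHS]metricE.
by rewrite (hess_linl (energy_smooth p) w u0) mulrDl scalerAl.
Qed.

Lemma metric_linr u v : slit u -> linear (fun w => metric L u v w).
Proof.
by move=> u0 a w w'; rewrite !(metric_symm v _ u0); exact: metric_linl.
Qed.

Lemma metric0l u w : metric L u 0 w = 0.
Proof. by rewrite /metric derive0 mul0r. Qed.

Lemma metric0r u v : slit u -> metric L u v 0 = 0.
Proof. by move=> u0; rewrite (metric_symm _ _ u0) metric0l. Qed.

Lemma metricNr u v w : slit u -> metric L u v (- w) = - metric L u v w.
Proof.
move=> u0; have := metric_linr v u0 (-1) w 0.
by rewrite (metric0r v u0) !addr0 !scaleN1r.
Qed.

Lemma metricNl u v w : slit u -> metric L u (- v) w = - metric L u v w.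
Proof. by move=> u0; rewrite !(metric_symm _ w u0) (metricNr _ _ u0). Qed.

Lemma metric_nondeg u v : slit u -> (forall e, metric L u v e = 0) -> v = 0.
Proof.
move=> u0 ve; apply/eqP; apply: contraT => v0.
by have [_ _ _ /(_ u u0 v v0)] := HF; rewrite ve ltxx.
Qed.

Lemma metric_expand u v w : slit u -> metric L u v w =
  \sum_i v 0 i * \sum_j w 0 j * metric L u (delta_mx 0 i) (delta_mx 0 j).
Proof.
move=> u0; rewrite (linear_expand v (metric_linl w u0)); apply: eq_bigr => i _.
by rewrite (linear_expand w (metric_linr _ u0)).
Qed.

Lemma gprod_fibre_diff (s t : TM -> E) p y : y != 0 ->
  differentiable (fun y' => s (p, y')) y -> differentiable (fun y' => t (p, y')) y ->
  differentiable (fun y' => gprod L s t (p, y')) y.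
Proof.
move=> y0 sd td.
have cd (f : E -> E) i : differentiable f y -> differentiable (fun y' => f y' 0 i) y.
  move=> fd; apply: (@differentiable_comp _ _ _ _ f (coord_rV i)) => //.
  by apply: linear_differentiable; exact: coord_rV_cont.
pose h i j y' := metric L (p, y') (delta_mx 0 i) (delta_mx 0 j).
have hd i j : differentiable (h i j) y.
  have := smooth_nonzero_diff (hess_smooth (energy_smooth p) (delta_mx 0 i) (delta_mx 0 j)) y0.
  by move=> hd; apply: differentiableM.
have : differentiable (\sum_i (fun y' => s (p, y') 0 i) *
  \sum_j (fun y' => t (p, y') 0 j) * h i j) y.
  apply: differentiable_sum => i; apply: differentiableM; first exact: cd.
  by apply: differentiable_sum => j; apply: differentiableM => //; exact: cd.
apply: near_eq_differentiable.
apply: filterS (near_neq0 y0) => y' y'0; rewrite /gprod (metric_expand _ _ (u := (p, y')) y'0).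
rewrite !fct_sumE; apply: eq_bigr => i _; rewrite -[LHS]/(_ * _); congr (_ * _).
by rewrite fct_sumE.
Qed.

End Metric.

(** * The Cartan connection *)

Section CartanConnection.
Context {R : realType} {n : nat} {M : topologicalType}.
Variable (A : smooth_atlas R n M).

Local Notation E := ('rV[R]_n).
Local Notation TM := (M * 'rV[R]_n)%type.
Local Notation chart_at := (chart_at A).
Local Notation slit := (@slit R n M).

Variables (L : TM -> R) (D : TM -> E * E -> (TM -> E) -> E).
Hypothesis HM : hausdorff_space M.
Hypothesis HF : finsler A L.
Hypothesis HD : cartan_connection A D L.

Implicit Types (p : M) (u q : TM) (x y v a b e : E).
Local Notation Gm := (vert_coeff A D).

Let lin : linear_connection A D. Proof. by case: HD. Qed.

Lemma metric_compatible (X : TM -> E * E) (Y Z : TM -> E) u :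
  vector_field A X -> pi_field A Y -> pi_field A Z -> slit u ->
  tderive A u (X u) (gprod L Y Z) =
  metric L u (D u (X u) Y) (Z u) + metric L u (Y u) (D u (X u) Z).
Proof. by move=> Xs Ys Zs u0; have [_ _ /(_ X Y Z Xs Ys Zs u u0) + _ _] := HD. Qed.

Lemma beta_spec q v : slit q -> conn_map D q (beta D q v) = 0 /\ rho (beta D q v) = v.
Proof.
move=> q0; have [_ /(_ q q0)[/(_ (v, 0))[a [b [a0 b0 vE]]] _] _ _ _] := HD.
apply: (@getPex _ [set w | conn_map D q w = 0 /\ rho w = v]); exists b; split=> //.
by have := congr1 fst vE; rewrite /= -[a.1]/(rho a) a0 add0r => ->.
Qed.

Lemma conn_vert_fibre (s : M -> E) p y b : y != 0 ->
  pi_smooth_at A (fun q => s q.1) (p, y) ->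
  D (p, y) (0, b) (fun q => s q.1) = Gm (p, y) b (s p).
Proof.
move=> y0 ss; rewrite (conn_vert lin b y0 ss).
by rewrite [X in X + _](derive_cst (s p) y b) add0r.
Qed.

(** A vertical field has no horizontal components, so one of the two terms of
the bracket is vertical. *)
Lemma lie_vert1 (X Y : TM -> E) p y :
  rho (lie_bracket A (vlift X) (hlift D Y) (p, y)) =
  ('D_(0, X (p, y)) (vf_rep A (chart_at p) (hlift D Y)) (cmap (chart_at p) p, y)).1.
Proof.
rewrite /lie_bracket [X in X.1]/= tm_coord_at /rho.
set z0 := (cmap _ p, y); rewrite -[LHS]/(_.1 - _.1).
rewrite [X in _ - X](_ : _ = 0) ?subr0//.
apply: (derive_pair1_line (k := 0)).
have cp : cdom (chart_at p) p := chart_at_dom A p.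
have Ac : in_atlas A (chart_at p) := chart_at_atlas A p.
have z0o : tm_overlap (chart_at p) (chart_at p) z0 by exact: overlap_map.
apply: filterS (near_line (hlift D Y (p, y)) (near_tm_overlap z0o)) => h /overlap_dom[cz _].
rewrite /vf_rep (tvec_coord1 _ Ac (u := Defs.tm_of A (chart_at p) (h *: _ + z0)) cz).
by rewrite [vec_coord _ _ _ _]derive0.
Qed.

(** The term of the torsion in which the projection of the vertical field is
differentiated is the derivative of the zero section. *)
Lemma hvtor_fibreE (X Y : TM -> E) p y : y != 0 -> pi_smooth_at A Y (p, y) ->
  hvtor A D X Y (p, y) = D (p, y) (0, X (p, y)) Y -
  ('D_(0, X (p, y)) (vf_rep A (chart_at p) (hlift D Y)) (cmap (chart_at p) p, y)).1.
Proof.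
move=> y0 Ys; have u0 : slit (p, y) := y0.
rewrite /hvtor /torsion lie_vert1; congr (_ - _).
rewrite /nabla [X in _ - X](_ : _ = 0); last exact: (conn_section0 lin).
rewrite subr0 -[vlift X (p, y)]/(0, X (p, y)).
apply/esym/(conn_local lin _ u0 Ys).
by apply: near_tmW (near_tm_slit (A := A) u0) => q q0; rewrite /= (beta_spec _ q0).2.
Qed.

(** The horizontal lift of a section that is constant along the fibres has
constant horizontal components along them, so the bracket with a vertical field
is vertical. *)
Lemma hvtor_fibre (s : M -> E) (X : TM -> E) p y : y != 0 ->
  pi_field A (fun q => s q.1) ->
  hvtor A D X (fun q => s q.1) (p, y) = Gm (p, y) (X (p, y)) (s p).
Proof.
move=> y0 ss; have u0 : slit (p, y) := y0.
rewrite (hvtor_fibreE _ y0 (ss _ u0)) (conn_vert_fibre _ y0 (ss _ u0)).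
rewrite (derive_pair1_line (k := s p)) ?subr0//.
apply: filterS (near_line (X (p, y)) (near_neq0 y0)) => h hy0.
rewrite (_ : h *: (0, X (p, y)) + (cmap (chart_at p) p, y) =
  (cmap (chart_at p) p, h *: X (p, y) + y)); last first.
  by congr pair; rewrite /= scaler0 add0r.
by rewrite vf_rep_fibre; exact: (beta_spec _ (q := (p, _)) hy0).2.
Qed.

Lemma vert_coeff_sym p y b a e : y != 0 ->
  metric L (p, y) (Gm (p, y) b a) e = metric L (p, y) (Gm (p, y) b e) a.
Proof.
move=> y0; have [X [s [Xs ss Xp sp _]]] := prescribed_fields A p HM.
have [_ _ _ _ /(_ _ _ _ (ss b) (ss a) (ss e) (p, y) y0)] := HD.
by rewrite /gprod (hvtor_fibre _ _ y0 (ss a)) (hvtor_fibre _ _ y0 (ss e)) !sp.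
Qed.

(** Metricity produces [g(G(b, a), e) + g(a, G(b, e))], and the symmetry of the
torsion makes the two terms equal. *)
Lemma derive_metric p y b a e : y != 0 ->
  'D_b (fun y' => metric L (p, y') a e) y = 2 * metric L (p, y) (Gm (p, y) b a) e.
Proof.
move=> y0; have u0 : slit (p, y) := y0.
have [X [s [Xs ss Xp sp _]]] := prescribed_fields A p HM.
have := metric_compatible (Xs (0, b)) (ss a) (ss e) u0.
rewrite Xp tderive_vert /gprod /= sp sp.
rewrite !(conn_vert_fibre b y0 (ss _ _ u0)) !sp => ->.
by rewrite (metric_symm HF a (Gm (p, y) b e) u0) (vert_coeff_sym p b e a y0) mulr2n mulrDl mul1r.
Qed.

Lemma derive_hess p y b a e : y != 0 ->
  'D_b (hess (fun y => L (p, y) ^+ 2) a e) y = 4 * metric L (p, y) (Gm (p, y) b a) e.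
Proof.
move=> y0; have := derive_metric p b a e y0.
rewrite (_ : (fun y' => metric L (p, y') a e) =
  2^-1 \*: hess (fun y => L (p, y) ^+ 2) a e); last first.
  by apply/funext => y'; rewrite metricE mulrC.
rewrite deriveZ; last first.
  exact: diff_derivable (smooth_nonzero_diff (hess_smooth (energy_smooth HF p) a e) y0).
rewrite -[_ *: _]/(_ * _) => h; apply: (@mulfI _ 2^-1) => //.
by rewrite h; move: (metric _ _ _ _) => m; field.
Qed.

(** By symmetry of the third derivatives, the derivative of [g(y, e)] in
direction [b] with [y] fixed is that of [g(b, e)] in the radial direction [y],
where Euler's identity applies. *)
Lemma vert_coeff_eta p y b : y != 0 -> Gm (p, y) b y = 0.
Proof.
move=> y0; apply: (metric_nondeg HF (u := (p, y)) y0) => e.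
have := derive_hess p b y e y0.
rewrite (derive_hess_radial2 (energy_smooth HF p) _ b e y0).
  by move=> /esym/eqP; rewrite mulf_eq0 pnatr_eq0 /= => /eqP.
by move=> k y'; exact: energy_homogeneous HF p k y'.
Qed.

Lemma conn_eta p y b : y != 0 -> D (p, y) (0, b) (@eta R n M) = b.
Proof.
move=> y0; rewrite (conn_vert lin b y0 (@eta_smooth _ _ _ A (p, y))).
by rewrite /eta /= vert_coeff_eta// addr0 derive_id.
Qed.

(** The vertical derivative of [eta] is the identity, so the vertical part of
the lift of [v] is minus the derivative of [eta] along [(v, 0)]. This exhibits
the smoothness of the lift along the fibre. *)
Lemma beta_formula p y v : y != 0 ->
  beta D (p, y) v = (v, - \sum_i v 0 i *: D (p, y) (delta_mx 0 i, 0) (@eta R n M)).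
Proof.
move=> y0; have u0 : slit (p, y) := y0.
have := beta_spec v u0; case: (beta D (p, y) v) => v' b'.
rewrite /conn_map /rho /= => -[+ v'E]; rewrite {}v'E.
rewrite [X in D _ X](_ : _ = (v, 0) + (0, b')); last first.
  by congr pair; rewrite ?addr0 ?add0r.
have es := @eta_smooth _ _ _ A (p, y).
rewrite (connD lin _ _ u0 es) conn_eta// => /eqP; rewrite addrC addr_eq0 => /eqP ->.
congr pair; congr (- _).
rewrite [in LHS](row_sum_delta v).
rewrite (big_morph (fun v : E => (v, 0) : E * E) (id1 := 0) (op1 := +%R))//; last first.
  by move=> x z; congr pair; rewrite addr0.
rewrite (conn_sum_dir lin _ _ u0 es); apply: eq_bigr => i _.
rewrite -(connZ lin _ _ u0 es); congr (D _ _ _).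
by congr pair; rewrite scaler0.
Qed.

(** * Concurrent fields *)

Section Concurrent.
Variable zeta : TM -> E.
Hypothesis HZ : concurrent A D zeta.

Let zs : pi_field A zeta. Proof. by case: HZ. Qed.

(** The two conditions of concurrency together: every tangent vector is a
horizontal lift plus a vertical vector. *)
Lemma conn_zeta p y a b : y != 0 -> D (p, y) (a, b) zeta = - a.
Proof.
move=> y0; have u0 : slit (p, y) := y0.
have [X [s [Xs ss Xp sp _]]] := prescribed_fields A p HM.
have vert b' : D (p, y) (0, b') zeta = 0.
  by have [_ /(_ _ (ss b') _ u0)[_ +]] := HZ; rewrite /nabla /vlift /= sp.
have hor : D (p, y) (beta D (p, y) a) zeta = - a.
  by have [_ /(_ _ (ss a) _ u0)[+ _]] := HZ; rewrite /nabla /hlift /= sp.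
have [_ rb] := beta_spec a u0.
have -> : (a, b) = beta D (p, y) a + (0, b - (beta D (p, y) a).2).
  rewrite -{1}rb; case: (beta D (p, y) a) => a' b'; congr pair => /=; first by rewrite addr0.
  by rewrite addrC subrK.
by rewrite (connD lin _ _ u0 (zs u0)) hor vert addr0.
Qed.

Lemma norm_vert p y b : y != 0 -> 'D_b (fun y' => gprod L zeta zeta (p, y')) y = 0.
Proof.
move=> y0; have u0 : slit (p, y) := y0.
have [X [s [Xs ss Xp sp _]]] := prescribed_fields A p HM.
have := metric_compatible (Xs (0, b)) zs zs u0.
rewrite Xp tderive_vert => ->.
by rewrite conn_zeta// oppr0 metric0l (metric0r HF _ u0) addr0.
Qed.

(** The derivative of [zeta] in the direction [(a, 0)] is [-a], whether or not
this lift of [a] is horizontal. *)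
Lemma norm_horiz p y a : y != 0 ->
  tderive A (p, y) (a, 0) (gprod L zeta zeta) = - 2 * metric L (p, y) a (zeta (p, y)).
Proof.
move=> y0; have u0 : slit (p, y) := y0.
have [X [s [Xs ss Xp sp _]]] := prescribed_fields A p HM.
have := metric_compatible (Xs (a, 0)) zs zs u0; rewrite Xp => ->.
rewrite (conn_zeta p a 0 y0) (metricNl HF a _ u0) (metricNr HF _ a u0).
by rewrite (metric_symm HF _ a u0); move: (metric _ _ _ _) => m; ring.
Qed.

Lemma zeta_fibre_diff p y : y != 0 -> differentiable (fun y' => zeta (p, y')) y.
Proof.
by move=> y0; apply: smooth_at_diff; exact: (pi_smooth_fibre (zs (u := (p, y)) y0)).
Qed.

Lemma norm_segment p y b : (forall t : R, 0 <= t <= 1 -> y + t *: b != 0) ->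
  gprod L zeta zeta (p, y + b) = gprod L zeta zeta (p, y).
Proof.
move=> yb; apply: (@constant_dir R _ (fun y' => gprod L zeta zeta (p, y')) y b) => t /yb y0.
split; last exact: norm_vert.
apply: diff_derivable; apply: (gprod_fibre_diff HF y0); exact: zeta_fibre_diff.
Qed.

(** The squared norm of [zeta] takes the same values at [y] and at [y + b], and
not only over [p]: over neighbouring points too, where the segment is transported
by the chart. Differentiate this equality in the direction [a] of the base. *)
Lemma zeta_form_segment p y a b : (forall t : R, 0 <= t <= 1 -> y + t *: b != 0) ->
  metric L (p, y + b) a (zeta (p, y + b)) = metric L (p, y) a (zeta (p, y)).
Proof.
move=> yb; have y0 : y != 0 by have := yb 0; rewrite scale0r addr0 lexx ler01; exact.
have yb0 : y + b != 0 by have := yb 1; rewrite scale1r ler01 lexx; exact.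
apply: (@mulfI _ (- 2)); first by rewrite oppr_eq0 pnatr_eq0.
refine (etrans (esym (norm_horiz p a yb0)) (etrans _ (norm_horiz p a y0))).
rewrite (tderive_horiz _ _ p (y + b)) (tderive_horiz _ _ p y).
apply: near_eq_derive.
set c := chart_at p; have Ac : in_atlas A c := chart_at_atlas A p.
have cp : cdom c p := chart_at_dom A p.
apply: filterS (near_overlap (overlap_map cp cp)) => x /overlap_dom[cx _].
rewrite /= /tm_of /=.
have lD : vec_of A c (cinv c x) (y + b) = vec_of A c (cinv c x) y + vec_of A c (cinv c x) b.
  by have := vec_of_lin Ac cx 1 y b; rewrite !scale1r.
rewrite lD; apply: norm_segment => t t01.
have := vec_of_neq0 Ac cx (yb t t01).
by rewrite addrC (vec_of_lin Ac cx t b y) addrC.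
Qed.

(** Differentiate [g(a, zeta)], which is constant along the fibre, in the
direction [b]: metricity leaves only [g(G(b, a), zeta)], as the vertical
derivative of [zeta] is zero. *)
Lemma vert_coeff_zeta p y a b : y != 0 ->
  metric L (p, y) (Gm (p, y) b a) (zeta (p, y)) = 0.
Proof.
move=> y0; have u0 : slit (p, y) := y0.
have [X [s [Xs ss Xp sp _]]] := prescribed_fields A p HM.
have := metric_compatible (Xs (0, b)) (ss a) zs u0.
rewrite Xp tderive_vert /gprod /= sp (conn_vert_fibre b y0 (ss a _ u0)) !sp.
rewrite conn_zeta// oppr0 (metric0r HF _ u0) addr0 => <-.
suff [] : is_derive y b (fun y' => metric L (p, y') a (zeta (p, y'))) 0 by [].
apply/is_deriveP => h h0; apply: filterS (segment_neq0 b y0) => k kb.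
have zE := zeta_form_segment p a kb.
rewrite [k *: b + y]addrC {}zE subrr; move: (ltW h0) => h0'.
by rewrite (_ : k *: 0 = 0) ?subr0 ?normr0 ?mulr_ge0//; exact: mulr0.
Qed.

Lemma vert_coeff_zeta0 p y b : y != 0 -> Gm (p, y) b (zeta (p, y)) = 0.
Proof.
move=> y0; apply: (metric_nondeg HF (u := (p, y)) y0) => e.
by rewrite vert_coeff_sym// vert_coeff_zeta.
Qed.

Lemma zeta_vert p y b : y != 0 -> 'D_b (fun y' => zeta (p, y')) y = 0.
Proof.
move=> y0; have := conn_vert lin b y0 (zs (u := (p, y)) y0).
by rewrite conn_zeta// vert_coeff_zeta0// oppr0 addr0.
Qed.

End Concurrent.

End CartanConnection.

(** * Vanishing of the torsion *)

Section Conclusion.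
Context {R : realType} {n : nat} {M : topologicalType}.
Variable (A : smooth_atlas R n M).

Local Notation E := ('rV[R]_n).
Local Notation TM := (M * 'rV[R]_n)%type.
Local Notation chart_at := (chart_at A).
Local Notation slit := (@slit R n M).

Variables (L : TM -> R) (D : TM -> E * E -> (TM -> E) -> E) (zeta : TM -> E).
Hypothesis HM : hausdorff_space M.
Hypothesis HF : finsler A L.
Hypothesis HD : cartan_connection A D L.
Hypothesis HZ : concurrent A D zeta.

Implicit Types (p : M) (u q : TM) (x y v a b e : E).
Local Notation Gm := (vert_coeff A D).

Let lin : linear_connection A D. Proof. by case: HD. Qed.
Let zs : pi_field A zeta. Proof. by case: HZ. Qed.

(** The section [N = G(b, a)] is orthogonal to [zeta] everywhere. Differentiating
along [(e, 0)], the derivative of [N] is paired with [zeta u = 0] and that of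
[zeta] is [-e]. *)
Lemma vert_coeff_at_zero p y a b : y != 0 -> zeta (p, y) = 0 -> Gm (p, y) b a = 0.
Proof.
move=> y0 z0; have u0 : slit (p, y) := y0.
have [X [s [Xs ss Xp sp X1]]] := prescribed_fields A p HM.
pose N q := D q (X (0, b) q) (fun q => s a q.1).
have Ns : pi_field A N.
  by move=> q q0; have [_ _ _ h] := lin; exact: (h q _ _ q0 (Xs (0, b) q q0) (ss a q q0)).
have Nz q : slit q -> gprod L N zeta q = 0.
  case: q => p' y' q0; rewrite /gprod /N.
  case: (X (0, b) (p', y')) (X1 b (p', y')) => a' b' /= ->.
  rewrite (conn_vert_fibre HD b' q0 (ss a _ q0)).
  exact: (vert_coeff_zeta HM HF HD HZ).
apply: (metric_nondeg HF u0) => e.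
have := metric_compatible HD (Xs (e, 0)) Ns zs u0.
rewrite tderive_slit0// z0 (metric0r HF _ u0) add0r Xp (conn_zeta HM HD HZ _ _ _ y0).
rewrite (metricNr HF _ _ u0) /N Xp (conn_vert_fibre HD b y0 (ss a _ u0)) sp.
by move=> /esym/eqP; rewrite oppr_eq0 => /eqP.
Qed.

Lemma zeta_segment p y b : (forall t : R, 0 <= t <= 1 -> y + t *: b != 0) ->
  zeta (p, y + b) = zeta (p, y).
Proof.
move=> yb; apply/rowP => i.
apply: (@constant_dir R _ (fun y' => zeta (p, y') 0 i) y b) => t /yb y0.
have := is_derive_lin_comp (coord_rV_cont (i := i))
  (derivableP (diff_derivable (v := b) (zeta_fibre_diff HZ p y0))).
by rewrite (zeta_vert HM HF HD HZ) // linear0.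
Qed.

(** By symmetry the derivative in the direction of [zeta] is [4 g(G(a, r), e)],
and [G(a, zeta) = 0]. *)
Lemma derive_hess_zeta p y a e r : y != 0 ->
  r = zeta (p, y) \/ r = - zeta (p, y) ->
  'D_r (hess (fun y => L (p, y) ^+ 2) a e) y = 0.
Proof.
move=> y0 rz.
have -> : 'D_r (hess (fun y => L (p, y) ^+ 2) a e) y =
    'D_a (hess (fun y => L (p, y) ^+ 2) r e) y.
  exact: (hess_commute (energy_smooth HF p) _ _ _ y0).
rewrite (derive_hess HM HF HD)//.
have Gz := vert_coeff_zeta0 HM HF HD HZ p a y0.
suff -> : Gm (p, y) a r = 0 by rewrite metric0l mulr0.
case: rz => ->//; rewrite -[RHS]oppr0 -Gz /vert_coeff -sumrN.
by apply: eq_bigr => i _; rewrite mxE scaleNr.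
Qed.

(** The field [zeta] keeps its value along the ray and at the points
[y + t r + h b] close to it, so the Hessian has zero derivative in the direction
[r] there. Exchanging the order of [D_r] and [D_b], the derivative in direction
[b] is constant along the ray. *)
Lemma vert_coeff_vanish p y a b : y != 0 -> Gm (p, y) b a = 0.
Proof.
move=> y0; have [z0|z0] := eqVneq (zeta (p, y)) 0; first exact: vert_coeff_at_zero.
apply: (metric_nondeg HF (u := (p, y)) y0) => e.
have [r rz yr] := ray_exists y0 z0.
have r0 : r != 0 by case: rz => ->; rewrite ?oppr_eq0.
have zr (t : R) : 0 <= t -> zeta (p, y + t *: r) = zeta (p, y).
  move=> t0; apply: zeta_segment => s /andP[s0 _].
  by rewrite scalerA; apply: yr; rewrite mulr_ge0.
have Es := energy_smooth HF p.
suff C0 : 'D_b (hess (fun y => L (p, y) ^+ 2) a e) y = 0.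
  have := derive_hess HM HF HD p b a e y0; rewrite C0 => /esym/eqP.
  by rewrite mulf_eq0 pnatr_eq0 => /eqP.
apply: (derive_hess_ray Es _ y0 r0 yr).
  by move=> k y'; exact: (energy_homogeneous HF p).
move=> t t0; have yt0 := yr t t0.
have -> : 'D_r ('D_b (hess (fun y => L (p, y) ^+ 2) a e)) (y + t *: r) =
    'D_b ('D_r (hess (fun y => L (p, y) ^+ 2) a e)) (y + t *: r).
  exact: (derive_commute _ _ _ nonzero_open (hess_smooth Es a e) yt0).
apply: derive0_line; apply: filterS (segment_neq0 b yt0) => h hb.
have hb0 : y + t *: r + h *: b != 0 by have := hb 1; rewrite scale1r ler01 lexx; exact.
rewrite addrC; apply: derive_hess_zeta => //.
by rewrite (zeta_segment p hb) zr.
Qed.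

(** Both the derivative of [Y] and the bracket reduce to the derivative of the
components of [Y]. Splitting off the horizontal component of the bracket
requires the lift of [Y] to be differentiable along the fibre. *)
Lemma hvtor_vanish X Y u : slit u -> pi_smooth_at A Y u -> hvtor A D X Y u = 0.
Proof.
case: u => p y u0 Ys; have y0 : y != 0 := u0.
rewrite (hvtor_fibreE HD X y0 Ys) (conn_vert lin _ y0 Ys) vert_coeff_vanish// addr0.
rewrite derive_vert.
have [Xf [s [Xs ss Xp sp X1]]] := prescribed_fields A p HM.
pose N i q := D q (Xf (delta_mx 0 i, 0) q) (@eta R n M).
have Nd i : differentiable (fun y' => N i (p, y')) y.
  apply/smooth_at_diff/pi_smooth_fibre; have [_ _ _ h] := lin.
  exact: (h _ _ _ u0 (Xs _ _ u0) (@eta_smooth _ _ _ A (p, y))).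
have Yd : differentiable (fun y' => Y (p, y')) y.
  by apply: smooth_at_diff; exact: (pi_smooth_fibre Ys).
pose B y' : E * E := (Y (p, y'), - \sum_i Y (p, y') 0 i *: N i (p, y')).
have Bd : derivable B y (X (p, y)).
  have Sd : differentiable (\sum_i (fun y' => Y (p, y') 0 i *: N i (p, y'))) y.
    apply: differentiable_sum => i; apply: differentiable_scale (Nd i).
    apply: (@differentiable_comp _ _ _ _ (fun y' => Y (p, y')) (coord_rV i)) => //.
    by apply: linear_differentiable; exact: coord_rV_cont.
  rewrite (_ : B = fun y' => (Y (p, y'), - (\sum_i (fun y' => Y (p, y') 0 i *: N i (p, y'))) y')).
    exact/diff_derivable/(differentiable_pair Yd)/differentiableN.
  by apply/funext => y'; rewrite /B fct_sumE.
rewrite (near_eq_derive (g := B)); last first.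
  apply: filterS (near_neq0 y0) => y' y'0; rewrite vf_rep_fibre /hlift.
  by rewrite (beta_formula HM HF HD _ _ y'0) /B /N; under [in RHS]eq_bigr do rewrite Xp.
by rewrite derive_pair1// subrr.
Qed.

Lemma metric_segment p y b v w : (forall t : R, 0 <= t <= 1 -> y + t *: b != 0) ->
  metric L (p, y + b) v w = metric L (p, y) v w.
Proof.
move=> yb; suff hE : hess (fun y => L (p, y) ^+ 2) v w (y + b) =
    hess (fun y => L (p, y) ^+ 2) v w y.
  by rewrite [LHS]metricE [RHS]metricE hE.
apply: (@constant_dir R _ (hess (fun y => L (p, y) ^+ 2) v w) y b) => t /yb y0.
split; last by rewrite (derive_hess HM HF HD)// vert_coeff_vanish// metric0l mulr0.
exact: diff_derivable (smooth_nonzero_diff (hess_smooth (energy_smooth HF p) v w) y0).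
Qed.

(** The segment between two nonzero vectors avoids the origin unless they point
in opposite directions; in that case a vector [e] that is not proportional to
them serves as an intermediate point, and such a vector exists when [n <> 1]. *)
Lemma riemannian_vanish : n <> 1%N -> riemannian L.
Proof.
move=> n1 p y y' y0 y'0 v w.
have join y1 y2 : y1 != 0 -> (forall k : R, 0 <= k -> y2 <> - k *: y1) -> y2 != 0 ->
    metric L (p, y1) v w = metric L (p, y2) v w.
  move=> y10 ny y20; rewrite -[y2](subrK y1) addrC; apply/esym/metric_segment.
  move=> t /andP[t0 t1]; apply/eqP => tE.
  have : t *: y2 = - (1 - t) *: y1.
    apply/eqP; rewrite -subr_eq0 scaleNr opprK -tE scalerBr scalerBl scale1r.
    by rewrite addrCA.
  have [->|tn0] := eqVneq t 0.
    by rewrite scale0r subr0 scaleN1r => /eqP; rewrite eq_sym oppr_eq0 (negbTE y10).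
  move=> /(congr1 ( *:%R t^-1)); rewrite scalerK// scalerA mulrN => y2E.
  apply: (ny (t^-1 * (1 - t))) => //.
  by rewrite mulr_ge0 ?invr_ge0 ?subr_ge0.
have [[k k0 yE]|nk] := pselect (exists2 k : R, 0 <= k & y' = - k *: y); last first.
  by apply: join => // k k0 yE; apply: nk; exists k.
have [e ne] : exists e : E, forall k : R, e <> k *: y.
  have /eqP/rowP/existsNP[i /eqP yi] := y0; rewrite mxE in yi.
  have /card_gt0P[j] : (0 < #|predC1 i|)%N.
    by rewrite cardC1 card_ord; case: n n1 i {yi} => [|[|n']] // _ [].
  rewrite inE => ji; exists (delta_mx 0 j) => l /rowP le.
  have := le i; rewrite !mxE eq_sym (negbTE ji) andbF => /esym/eqP.
  rewrite mulf_eq0 (negbTE yi) orbF => /eqP l0.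
  by have := le j; rewrite !mxE l0 mul0r !eqxx => /eqP; rewrite oner_eq0.
have e0 : e != 0 by apply/eqP => eE; apply: (ne 0); rewrite scale0r.
transitivity (metric L (p, e) v w).
  by apply: join => // k' _; exact: ne.
apply: join => // k' k'0 y'E; have k'n0 : k' != 0.
  by apply: contra_neq y'0 => k'E; rewrite y'E k'E oppr0 scale0r.
apply: (ne (- k'^-1 * - k)); rewrite -scalerA -yE y'E scalerA mulrNN mulVf//.
by rewrite scale1r.
Qed.

Lemma T_condition_vanish : T_condition A D L.
Proof.
move=> X Y Z W Xs Ys Zs Ws u u0.
have C0 (X' Y' Z' : TM -> E) q : slit q -> pi_smooth_at A Y' q ->
    cartan_tensor A D L X' Y' Z' q = 0.
  by move=> q0 Ys'; rewrite /cartan_tensor /gprod (hvtor_vanish X' q0 Ys') metric0l.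
have nZ : pi_smooth_at A (nabla D (vlift X) Z) u.
  have [_ _ _ h] := lin.
  exact: (h u (vlift X) Z u0 (vlift_smooth (Xs u u0)) (Zs u u0)).
have t0 : tderive A u (vlift X u) (cartan_tensor A D L Y Z W) = 0.
  by apply: tderive_slit0 u0 _ => q q0; exact: (C0 _ _ _ q q0 (Zs q q0)).
rewrite /nabla_cartan_tensor t0 (C0 _ _ _ u u0 (Zs u u0)) (C0 _ _ _ u u0 nZ).
rewrite (C0 _ _ _ u u0 (Zs u u0)) (C0 _ _ _ u u0 (Zs u u0)) (C0 _ _ _ u u0 (Ws u u0)).
rewrite (C0 _ _ _ u u0 (Xs u u0)) (C0 _ _ _ u u0 (Ys u u0)).
move: (L u) (ell L X u) (ell L Y u) (ell L Z u) (ell L W u) => l a b c d.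
by ring.
Qed.

Lemma Ctrace_vanish X u : slit u -> Ctrace A D X u = 0.
Proof.
move=> u0; rewrite /Ctrace big1// => i _.
have fs : pi_smooth_at A (frame A (chart_at u.1) i) u.
  exact: (pi_smooth_vec_of _ (chart_at_atlas A u.1) (chart_at_dom A u.1)).
by rewrite (hvtor_vanish X u0 fs) mxE.
Qed.

Lemma To_condition_vanish : To_condition A D L.
Proof.
move=> X Y _ _ u u0; rewrite /nabla_Ctrace !(Ctrace_vanish _ u0).
rewrite (tderive_slit0 _ _ u0 (fun q => Ctrace_vanish Y (u := q))).
by move: (L u) (ell L X u) (ell L Y u) => l a b; ring.
Qed.

End Conclusion.

Theorem theorem3p11 (R : realType) (n : nat) (M : topologicalType)
    (A : smooth_atlas R n M) (L : M * 'rV[R]_n -> R)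
    (D : M * 'rV[R]_n -> 'rV[R]_n * 'rV[R]_n ->
         (M * 'rV[R]_n -> 'rV[R]_n) -> 'rV[R]_n)
    (zeta : M * 'rV[R]_n -> 'rV[R]_n) :
  hausdorff_space M -> paracompact M ->
  finsler A L -> cartan_connection A D L -> concurrent A D zeta ->
  [/\ T_condition A D L <-> To_condition A D L,
      To_condition A D L <-> hvtor_zero A D
    & n <> 1%N -> (To_condition A D L <-> riemannian L)].
Proof.
move=> HM _ HF HD HZ.
have T0 := T_condition_vanish HM HF HD HZ.
have To0 := To_condition_vanish HM HF HD HZ.
split; first by split.
  split=> // _ X Y _ Ys u u0.
  exact: (hvtor_vanish HM HF HD HZ X u0 (Ys u u0)).
by move=> n1; split=> // _; exact: (riemannian_vanish HM HF HD HZ n1).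
Qed.
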